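(* The following two assertions are equivalent. (A) Every bipartite cubic 2FH-graph other than the cubic graph on two vertices can be obtained from the complete bipartite graph $K_{3,3}$ and the Heawood graph by repeated star products. (B) Every bipartite cyclically 4-edge-connected cubic PMH-graph with girth at least $6$, except the Heawood graph, admits a perfect matching which can be extended to a Hamiltonian cycle in exactly one way.
   Context: Graphs are finite and connected, may have multiple (parallel) edges, and have no loops (two parallel edges form a cycle of length 2 for the purposes of girth). A cubic graph is a 3-regular graph. A $2$-factor is a $2$-regular spanning subgraph (not necessarily connected; two parallel edges count as a $2$-regular component), a Hamiltonian cycle is a connected $2$-factor, and a perfect matching is the edge set of a $1$-regular spanning subgraph. A graph is 2FH (2-factor Hamiltonian) if it has a Hamiltonian cycle and each of its $2$-factors is a Hamiltonian cycle. A graph $G$ admitting a perfect matching is PMH if for every perfect matching $M$ of $G$ there is a perfect matching $N$ of $G$ such that $M\cup N$ induces a Hamiltonian cycle of $G$ ($M$ is extended to that Hamiltonian cycle). $M$ can be extended to a Hamiltonian cycle in exactly one way if there is a unique perfect matching $N$ such that $M\cup N$ induces a Hamiltonian cycle. Star product: let $v_1\in V(G_1)$, $v_2\in V(G_2)$ be vertices of degree 3, with incident edges $v_1x_1,v_1y_1,v_1z_1$ and $v_2x_2,v_2y_2,v_2z_2$ respectively. A star product on $v_1$ and $v_2$ (between $G_1$ and $G_2$) is any graph of the form $(G_1-v_1)\cup(G_2-v_2)\cup\{x_1x_2,y_1y_2,z_1z_2\}$, for any choice of the ordering of the three neighbours. A graph obtained from $K_{3,3}$ and the Heawood graph by repeated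 star products is any member of the smallest class of graphs that contains $K_{3,3}$ and the Heawood graph and is closed under star products between members of the class. An edge-cut $X$ of $G$ is cycle-separating if at least two components of $G-X$ contain cycles. $G$ is cyclically $k$-edge-connected if it has no cycle-separating edge-cut with fewer than $k$ edges. *)

(* Defs.v *)
From mathcomp Require Import all_boot.

Set Implicit Arguments.
Unset Strict Implicit.
Unset Printing Implicit Defensive.

(** Finite loopless multigraphs: distinct edges may have the same ends. *)
Record mgraph := MGraph {
  vertex : finType;
  edge : finType;
  ends : edge -> {set vertex};
  card_ends : forall e, #|ends e| = 2
}.

Definition isomorphic (G H : mgraph) : Prop :=
  exists (f : vertex G -> vertex H) (g : edge G -> edge H),
    [/\ bijective f, bijective g & forall e, ends (g e) = f @: ends e].

Section MultigraphNotions.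

Variable G : mgraph.
Implicit Types (u v : vertex G) (F C M N X : {set edge G}) (K : {set vertex G}).

(** An edge set [F] stands for the spanning subgraph (V(G), F). *)

Definition deg F v : nat := #|[set e in F | v \in ends e]|.

Definition adj F : rel (vertex G) :=
  [rel u v | [exists e in F, ends e == [set u; v]]].

Definition spanning_connected F : bool :=
  [forall u, forall v, connect (adj F) u v].

(** The graph without vertices is not considered connected. *)
Definition connected : bool :=
  (0 < #|vertex G|) && spanning_connected setT.

Definition cubic : bool := [forall v, deg setT v == 3].

Definition bipartite : Prop :=
  exists A : {set vertex G}, forall e, #|ends e :&: A| = 1.

Definition two_factor F : bool := [forall v, deg F v == 2].

Definition hamiltonian_cycle F : bool := two_factor F && spanning_connected F.

Definition perfect_matching M : bool := [forall v, deg M v == 1].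

Definition two_factor_hamiltonian : Prop :=
  (exists F, hamiltonian_cycle F) /\
  (forall F, two_factor F -> hamiltonian_cycle F).

(** The perfect matching [N] extends [M] to a Hamiltonian cycle. *)
Definition extends_to_ham M N : bool :=
  perfect_matching N && hamiltonian_cycle (M :|: N).

Definition PMH : Prop :=
  (exists M, perfect_matching M) /\
  (forall M, perfect_matching M -> exists N, extends_to_ham M N).

(** Edge sets of connected 2-regular subgraphs; two parallel edges form a
    cycle. *)
Definition cycle_set C : bool :=
  [&& C != set0,
      [forall v, (deg C v == 0) || (deg C v == 2)] &
      [forall u, forall v,
         (0 < deg C u) && (0 < deg C v) ==> connect (adj C) u v]].

Definition girth_geq (k : nat) : Prop := forall C, cycle_set C -> k <= #|C|.

(** [K] is (the vertex set of) a component of G - X. *)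
Definition component X K : bool :=
  [exists u, K == [set v | connect (adj (~: X)) u v]].

Definition edge_cut X : bool := ~~ spanning_connected (~: X).

Definition contains_cycle X K : bool :=
  [exists C : {set edge G},
    [&& cycle_set C, C \subset ~: X & [forall e in C, ends e \subset K]]].

Definition cycle_separating X : Prop :=
  edge_cut X /\
  exists K1 K2, [/\ component X K1, component X K2, K1 != K2,
                    contains_cycle X K1 & contains_cycle X K2].

Definition cyclically_edge_connected (k : nat) : Prop :=
  forall X, cycle_separating X -> k <= #|X|.

End MultigraphNotions.

Arguments connected : clear implicits.
Arguments cubic : clear implicits.
Arguments bipartite : clear implicits.
Arguments two_factor_hamiltonian : clear implicits.
Arguments PMH : clear implicits.
Arguments girth_geq : clear implicits.
Arguments cyclically_edge_connected : clear implicits.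

Section StarProduct.

(** [a i] and [b i], for [i < 3], are the edges at [v1] and at [v2]; the
    numbering of the edges says which ones are glued together. *)
Variables (G1 G2 : mgraph) (v1 : vertex G1) (v2 : vertex G2).
Variables (a : 'I_3 -> edge G1) (b : 'I_3 -> edge G2).
Hypothesis (av1 : forall i, v1 \in ends (a i)).
Hypothesis (bv2 : forall i, v2 \in ends (b i)).

Definition star_vertex : finType :=
  ({x : vertex G1 | x != v1} + {y : vertex G2 | y != v2})%type.

Definition star_edge : finType :=
  ({e : edge G1 | v1 \notin ends e} + {e : edge G2 | v2 \notin ends e}
   + 'I_3)%type.

(** The new edge [i] joins the neighbour of [v1] along [a i] to the neighbour
    of [v2] along [b i]. *)
Definition star_ends (e : star_edge) : {set star_vertex} :=
  match e with
  | inl (inl e1) =>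
      [set w : star_vertex | if w is inl x then val x \in ends (val e1)
                             else false]
  | inl (inr e2) =>
      [set w : star_vertex | if w is inr y then val y \in ends (val e2)
                             else false]
  | inr i =>
      [set w : star_vertex | match w with
                             | inl x => val x \in ends (a i)
                             | inr y => val y \in ends (b i)
                             end]
  end.

Lemma card_sub_ends (G : mgraph) (v : vertex G) (e : edge G) :
  #|[set x : {x : vertex G | x != v} | val x \in ends e]| =
  #|ends e :\ v|.
Proof.
rewrite -(card_imset _ val_inj); apply: eq_card => x.
rewrite in_setD1; apply/imsetP/andP => [[y yP ->]|[xv xe]].
  by rewrite inE in yP; rewrite yP (valP y).
by exists (Sub x xv); rewrite ?inE.
Qed.

Lemma card_star_vertex (S : {set star_vertex}) :
  #|S| = #|[set x | inl x \in S]| + #|[set y | inr y \in S]|.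
Proof.
rewrite -!sum1_card big_sumType /=.
by congr (_ + _); apply: eq_bigl => x; rewrite inE.
Qed.

Lemma card_ends_setD1 (G : mgraph) (v : vertex G) (e : edge G) :
  #|ends e :\ v| = (v \notin ends e).+1.
Proof.
by apply: (@addnI (v \in ends e)); rewrite -cardsD1 card_ends; case: (v \in _).
Qed.

Lemma card_star_ends e : #|star_ends e| = 2.
Proof.
rewrite card_star_vertex.
case: e => [[e1|e2]|i].
- have -> : [set y | inr y \in star_ends (inl (inl e1))] = set0.
    by apply/setP=> y; rewrite !inE.
  have -> : [set x | inl x \in star_ends (inl (inl e1))] =
            [set x | val x \in ends (val e1)].
    by apply/setP=> x; rewrite !inE.
  by rewrite card_sub_ends card_ends_setD1 (valP e1) cards0.
- have -> : [set x | inl x \in star_ends (inl (inr e2))] = set0.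
    by apply/setP=> x; rewrite !inE.
  have -> : [set y | inr y \in star_ends (inl (inr e2))] =
            [set y | val y \in ends (val e2)].
    by apply/setP=> y; rewrite !inE.
  by rewrite card_sub_ends card_ends_setD1 (valP e2) cards0.
have -> : [set x | inl x \in star_ends (inr i)] = [set x | val x \in ends (a i)].
  by apply/setP=> x; rewrite !inE.
have -> : [set y | inr y \in star_ends (inr i)] = [set y | val y \in ends (b i)].
  by apply/setP=> y; rewrite !inE.
by rewrite !card_sub_ends !card_ends_setD1 av1 bv2.
Qed.

Definition star_graph : mgraph := MGraph card_star_ends.

End StarProduct.

(** The hypotheses [deg = 3], [injective a] and [v1 \in ends (a i)] say that
    [a] is an enumeration of the edges at [v1]; likewise for [b] and [v2]. *)
Definition star_product (G1 G2 H : mgraph) : Prop :=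
  exists (v1 : vertex G1) (v2 : vertex G2)
         (a : 'I_3 -> edge G1) (b : 'I_3 -> edge G2)
         (av1 : forall i, v1 \in ends (a i))
         (bv2 : forall i, v2 \in ends (b i)),
    [/\ deg setT v1 = 3, deg setT v2 = 3, injective a, injective b
      & isomorphic (star_graph av1 bv2) H].

Section IncidenceGraph.

Variables (A B : finType) (r : A -> B -> bool).

Definition incidence_ends (p : {p : A * B | r p.1 p.2}) : {set A + B} :=
  [set inl (val p).1; inr (val p).2].

Lemma card_incidence_ends p : #|incidence_ends p| = 2.
Proof. by rewrite cards2. Qed.

Definition incidence_graph : mgraph := MGraph card_incidence_ends.

End IncidenceGraph.

Definition K33 : mgraph := incidence_graph (fun _ _ : 'I_3 => true).

(** The incidence graph of the Fano plane, given by the difference set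
    {0, 1, 3} modulo 7. *)
Definition heawood : mgraph :=
  incidence_graph (fun p l : 'I_7 =>
    has (fun d => (p + d) %% 7 == l) [:: 0; 1; 3]).

(** The cubic graph on two vertices: three parallel edges. *)
Lemma card_theta_ends (e : 'I_3) : #|[set: 'I_2]| = 2.
Proof. by rewrite cardsT card_ord. Qed.

Definition theta : mgraph := MGraph card_theta_ends.

Inductive star_generated : mgraph -> Prop :=
  | star_generated_K33 G : isomorphic K33 G -> star_generated G
  | star_generated_heawood G : isomorphic heawood G -> star_generated G
  | star_generated_star G1 G2 H :
      star_generated G1 -> star_generated G2 -> star_product G1 G2 H ->
      star_generated H.

(* Main.v *)
Require Import Defs.
From Stdlib Require Import Classical_Prop.
From mathcomp Require Import all_boot zify.

Set Implicit Arguments.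
Unset Strict Implicit.
Unset Printing Implicit Defensive.

(** In a cubic graph the complement of a perfect matching is a 2-factor, and
    conversely.  A Hamiltonian cycle arises from exactly two ordered pairs of
    perfect matchings and is determined by its complement, so if every perfect
    matching extends in at least two ways, there are as many Hamiltonian cycles
    as perfect matchings and the graph is 2FH.  In a bipartite 2FH graph no
    perfect matching has a unique extension.  Hence (B) says that the Heawood
    graph is the only bipartite cyclically 4-edge-connected cubic 2FH graph of
    girth at least 6.

    This follows from (A) because both sides of a star product contain cycles
    and are separated by the three new edges.  For the converse, a nontrivial
    3-edge-cut exhibits a bipartite cubic 2FH graph as a star product of two
    smaller ones, namely the contractions of its two shores; without such a cut
    the graph is cyclically 4-edge-connected, and a short cycle forces it to be
    [K33] or [theta]. *)

Lemma card_setI_sum (T : finType) (F X : {set T}) :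
  #|F :&: X| = \sum_(e in F) (e \in X).
Proof.
rewrite -sum1_card (eq_bigl (fun e => (e \in F) && (e \in X))); last first.
  by move=> e; rewrite inE.
by rewrite big_mkcondr; apply: eq_bigr => e _; case: (e \in X).
Qed.

Section Basics.

Variable G : mgraph.
Implicit Types (u v w : vertex G) (e : edge G) (F C M N X : {set edge G}).
Implicit Types (A K S : {set vertex G}).

Definition cut K : {set edge G} := [set e | #|ends e :&: K| == 1].

Definition regular r F : bool := [forall v, deg F v == r].

Definition cov F : {set vertex G} := [set v | 0 < deg F v].

Lemma regularP r F : reflect (forall v, deg F v = r) (regular r F).
Proof. by apply: (iffP forallP) => h v; apply/eqP. Qed.

Lemma degE F v : deg F v = \sum_(e in F) (v \in ends e).
Proof.
rewrite /deg -sum1_card.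
rewrite [LHS](eq_bigl (fun e => (e \in F) && (v \in ends e))); last first.
  by move=> e; rewrite inE.
by rewrite [LHS]big_mkcondr; apply: eq_bigr => e _; case: (v \in _).
Qed.

Lemma deg_gt0P F v : reflect (exists2 e, e \in F & v \in ends e) (0 < deg F v).
Proof.
apply: (iffP card_gt0P) => [[e]|[e eF ve]].
  by rewrite inE => /andP[? ?]; exists e.
by exists e; rewrite inE eF.
Qed.

Lemma deg_setUI F X v : deg (F :|: X) v + deg (F :&: X) v = deg F v + deg X v.
Proof.
rewrite /deg -[RHS]cardsUI; congr (_ + _); apply: eq_card => e;
  by rewrite !inE; do 3 case: (_ \in _).
Qed.

Lemma deg_set0 v : deg set0 v = 0.
Proof. by rewrite degE big_set0. Qed.

Lemma deg_setID F X v : deg (F :&: X) v + deg (F :\: X) v = deg F v.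
Proof.
rewrite -[in RHS](setID F X) -[LHS]deg_setUI setIDA setIAC -setIDA setDv setI0.
by rewrite deg_set0 addn0.
Qed.

Lemma deg_sub F X v : F \subset X -> deg F v <= deg X v.
Proof. by move/setIidPr => h; rewrite -(deg_setID X F v) h leq_addr. Qed.

Lemma deg_eq0 F : (forall v, deg F v = 0) -> F = set0.
Proof.
move=> h; apply/setP=> e; rewrite inE; apply/negP => eF.
have [v ve] : exists v, v \in ends e by apply/card_gt0P; rewrite card_ends.
have : 0 < deg F v by apply/deg_gt0P; exists e.
by rewrite h.
Qed.

Lemma regularD r s F X : F \subset X -> regular r F -> regular s X ->
  regular (s - r) (X :\: F).
Proof.
move=> /setIidPr FX /regularP rF /regularP rX; apply/regularP => v.
by rewrite -(rX v) -(deg_setID X F v) FX rF addKn.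
Qed.

Lemma regularU r s F X : [disjoint F & X] -> regular r F -> regular s X ->
  regular (r + s) (F :|: X).
Proof.
move=> dis /regularP rF /regularP rX; apply/regularP => v.
have := deg_setUI F X v; move: dis; rewrite -setI_eq0 => /eqP ->.
by rewrite deg_set0 addn0 rF rX.
Qed.

Lemma ends2 e u v : u \in ends e -> v \in ends e -> u != v -> ends e = [set u; v].
Proof.
move=> ue ve uv; apply/esym/eqP; rewrite eqEcard card_ends cards2 uv andbT.
by apply/subsetP => w; rewrite !inE => /orP[] /eqP ->.
Qed.

Lemma connect_ends F e u v :
  e \in F -> u \in ends e -> v \in ends e -> connect (adj F) u v.
Proof.
move=> eF ue ve; have [->|uv] := eqVneq u v; first exact: connect0.
by apply: connect1; apply/existsP; exists e; rewrite eF (ends2 ue ve uv) eqxx.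
Qed.

Lemma cutP e K : reflect (exists u v, [/\ u \in ends e, v \in ends e, u \in K & v \notin K])
  (e \in cut K).
Proof.
have := cardsID K (ends e); rewrite card_ends inE => h.
apply: (iffP idP) => [/eqP h1|[u [v [ue ve uK vK]]]].
  have /card_gt0P[u] : 0 < #|ends e :&: K| by rewrite h1.
  have /card_gt0P[v] : 0 < #|ends e :\: K| by lia.
  by rewrite !inE => /andP[? ?] /andP[? ?]; exists u, v.
have : 0 < #|ends e :&: K| by apply/card_gt0P; exists u; rewrite inE ue.
have : 0 < #|ends e :\: K| by apply/card_gt0P; exists v; rewrite inE ve vK.
lia.
Qed.

Lemma cutC K : cut (~: K) = cut K.
Proof.
apply/setP => e; apply/cutP/cutP => -[u [v [ue ve]]]; rewrite ?inE => uK vK;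
  by exists v, u; rewrite ?inE; split => //; apply/negPn.
Qed.

Lemma connect_cut F S u v :
  F :&: cut S = set0 -> connect (adj F) u v -> u \in S -> v \in S.
Proof.
move=> h /connectP[p]; elim: p u => [|w p IH] u /=; first by move=> _ ->.
case/andP => /existsP[e /andP[eF /eqP ee]] pth lst uS.
apply: IH pth lst _; apply/negPn/negP => wS.
suff : e \in F :&: cut S by rewrite h inE.
by rewrite inE eF; apply/cutP; exists u, w; rewrite ee !inE !eqxx orbT.
Qed.

Lemma spanning_connectedP F :
  reflect (forall S u v, u \in S -> v \notin S -> exists2 e, e \in F & e \in cut S)
    (spanning_connected F).
Proof.
apply: (iffP forallP) => [h S u v uS vS|h u].
  have /forallP/(_ v) uv := h u.
  case: (set_0Vmem (F :&: cut S)) => [h0|[e]].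
    by rewrite (connect_cut h0 uv uS) in vS.
  by rewrite inE => /andP[? ?]; exists e.
apply/forallP => v; apply/negPn/negP => uv.
have [||e eF /cutP[x [y [xe ye]]]] := h [set w | connect (adj F) u w] u v.
- by rewrite inE connect0.
- by rewrite inE.
rewrite !inE => ux /negP[]; apply: (connect_trans ux).
exact: connect_ends xe ye.
Qed.

Lemma handshake F K : \sum_(v in K) deg F v = \sum_(e in F) #|ends e :&: K|.
Proof.
under eq_bigr do rewrite degE.
rewrite exchange_big /=; apply: eq_bigr => e _.
rewrite -sum1_card [RHS](eq_bigl (fun v => (v \in K) && (v \in ends e))); last first.
  by move=> v; rewrite inE andbC.
by rewrite [RHS]big_mkcondr; apply: eq_bigr => v _; case: (v \in ends e).
Qed.

Lemma handshakeT F : \sum_v deg F v = 2 * #|F|.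
Proof.
have := handshake F setT; rewrite big_mkcond /=.
under eq_bigr do rewrite inE.
by move=> ->; under eq_bigr do rewrite setIT card_ends; rewrite sum_nat_const mulnC.
Qed.

Lemma sum_deg_cov F : \sum_(v in cov F) deg F v = 2 * #|F|.
Proof.
rewrite -handshakeT big_mkcond /=; apply: eq_bigr => v _; rewrite inE.
by case: posnP => [->|].
Qed.

Lemma regular_sum r F K : regular r F -> \sum_(v in K) deg F v = r * #|K|.
Proof.
by move/regularP=> h; under eq_bigr do rewrite h; rewrite sum_nat_const mulnC.
Qed.

Lemma sub_cov F X : F \subset X -> cov F \subset cov X.
Proof.
move=> FX; apply/subsetP => v; rewrite !inE => h; exact: leq_trans h (deg_sub v FX).
Qed.

(* A nonempty edge set that is minimal with [#|cov F| <= #|F|] is a cycle. *)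
Lemma cycle_in F :
  F != set0 -> #|cov F| <= #|F| -> exists2 C, cycle_set C & C \subset F.
Proof.
have [n] := ubnP #|F|; elim: n F => // n IH F ltn Fn0 covF.
case: (boolP [exists D : {set edge G}, [&& D \proper F, D != set0 & #|cov D| <= #|D|]]).
  case/existsP => D /and3P[DF Dn0 covD].
  have [|C cC CD] := IH D _ Dn0 covD.
    by have := proper_card DF; lia.
  by exists C => //; apply: subset_trans CD (proper_sub DF).
rewrite negb_exists => /forallP noD; exists F => //.
have noD1 (D : {set edge G}) : D \subset F -> D != set0 -> #|cov D| <= #|D| -> D = F.
  move=> DF Dn0 covD; apply/eqP; have := noD D.
  by rewrite Dn0 covD !andbT properEneq DF andbT negbK.
have rmv e : e \in F -> cov (F :\ e) = cov F /\ #|cov F| = #|F|.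
  move=> eF; have cF := cardsD1 e F; rewrite eF in cF.
  have sub := sub_cov (subD1set F e).
  have Dn0 : F :\ e != set0.
    apply/negP => /eqP D0; rewrite D0 cards0 in cF.
    have : ends e \subset cov F.
      by apply/subsetP => v ve; rewrite inE; apply/deg_gt0P; exists e.
    by move/subset_leq_card; rewrite card_ends; lia.
  have lt : #|F :\ e| < #|cov (F :\ e)|.
    rewrite ltnNge; apply/negP => /(noD1 _ (subD1set F e) Dn0) h.
    by move: cF; rewrite h; lia.
  have le := subset_leq_card sub.
  by split; last lia; apply/eqP; rewrite eqEcard sub; lia.
have [e0 e0F] := set0Pn _ Fn0; have [_ cF] := rmv e0 e0F.
have deg2 v : v \in cov F -> 2 <= deg F v.
  rewrite inE => /deg_gt0P[e eF ve]; have [h _] := rmv e eF.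
  have : v \in cov (F :\ e) by rewrite h inE; apply/deg_gt0P; exists e.
  rewrite inE => /deg_gt0P[e']; rewrite !inE => /andP[ne e'F] ve'.
  rewrite /deg (cardsD1 e) inE eF ve (cardsD1 e') !inE ne e'F ve'; lia.
have deg2e v : v \in cov F -> deg F v = 2.
  move=> vF; have := sum_deg_cov F.
  rewrite (bigD1 v) //= -cF (cardD1 v) vF.
  have : \sum_(i in cov F | i != v) 2 <= \sum_(i in cov F | i != v) deg F i.
    by apply: leq_sum => i /andP[+ _]; exact: deg2.
  have := deg2 v vF; rewrite sum_nat_const.
  have -> : #|[pred i in cov F | i != v]| = #|[predD1 cov F & v]|.
    by apply: eq_card => i; rewrite !inE andbC.
  lia.
apply/and3P; split=> //.
  apply/forallP => v; case: (posnP (deg F v)) => [-> //|h].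
  by rewrite deg2e ?orbT // inE.
apply/forallP => u; apply/forallP => v; apply/implyP => /andP[uF vF].
pose S := [set w | connect (adj F) u w].
pose D := [set e in F | ends e \subset S].
have DF : D \subset F by apply/subsetP => e; rewrite inE => /andP[].
have degD w : w \in S -> deg D w = deg F w.
  move=> wS; apply: eq_card => e; rewrite !inE; apply: andb_id2r => we.
  apply: andb_idr => eF; apply/subsetP => x xe; rewrite inE.
  by rewrite inE in wS; apply: connect_trans wS (connect_ends eF we xe).
have covS : cov D \subset S.
  apply/subsetP => w; rewrite inE => /deg_gt0P[e]; rewrite inE => /andP[_ /subsetP].
  by move=> h /h.
have uS : u \in S by rewrite inE connect0.
have DE : D = F.
  apply: noD1 => //.
    apply/set0Pn; have /deg_gt0P[e eD _] : 0 < deg D u by rewrite degD.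
    by exists e.
  have := sum_deg_cov D.
  rewrite (eq_bigr (fun=> 2)) ?sum_nat_const; first lia.
  move=> w wD; rewrite degD ?(subsetP covS) // deg2e //.
  exact: (subsetP (sub_cov DF)).
have : v \in cov D by rewrite DE inE.
by move/(subsetP covS); rewrite inE.
Qed.

End Basics.

Section Bipartite.

Variable G : mgraph.
Implicit Types (u v w : vertex G) (e : edge G) (F C M N X : {set edge G}).
Implicit Types (K S T : {set vertex G}).

Definition bipartition (A : {set vertex G}) := forall e, #|ends e :&: A| = 1.

Lemma bipartitionC A : bipartition A -> bipartition (~: A).
Proof. by move=> bA e; have := cardsID A (ends e); rewrite card_ends bA setDE; lia. Qed.

Variable A : {set vertex G}.
Hypothesis bA : bipartition A.

Lemma bip_mem e u v : u \in ends e -> v \in ends e -> u \in A -> (v \in A) = (v == u).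
Proof.
move=> ue ve uA; have /cards1P[w hw] : #|ends e :&: A| == 1 by rewrite bA.
have : u \in [set w] by rewrite -hw inE ue uA.
rewrite inE => /eqP->; apply/idP/eqP => [vA|vw].
  by apply/set1P; rewrite -hw inE ve vA.
have : w \in ends e :&: A by rewrite hw inE.
by rewrite vw inE => /andP[].
Qed.

Lemma bip_ends e : exists u v, [/\ ends e = [set u; v], u \in A & v \notin A].
Proof.
have /cards1P[u hu] : #|ends e :&: A| == 1 by rewrite bA.
have /cards1P[v hv] : #|ends e :&: ~: A| == 1 by rewrite (bipartitionC bA).
exists u, v; split; first by rewrite -(setID (ends e) A) setDE hu hv.
  by have /setP/(_ u) := hu; rewrite !inE eqxx => /andP[].
have : v \in ends e :&: ~: A by rewrite hv inE.
by rewrite !inE => /andP[].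
Qed.

Lemma sum_deg_side F : \sum_(v in A) deg F v = #|F|.
Proof.
rewrite handshake; under eq_bigr do rewrite bA.
by rewrite sum_nat_const muln1.
Qed.

End Bipartite.

Lemma bip_card (G : mgraph) (A : {set vertex G}) r (F : {set edge G}) :
  bipartition A -> 0 < r -> regular r F -> #|A| = #|~: A|.
Proof.
move=> bA r0 rF; have := sum_deg_side bA F.
rewrite -(sum_deg_side (bipartitionC bA)) !(regular_sum _ rF) => /eqP.
by rewrite eqn_pmul2l // => /eqP.
Qed.

Section Hall.

Variables (G : mgraph) (A : {set vertex G}).
Hypothesis bA : bipartition A.
Implicit Types (u v w : vertex G) (e : edge G) (F C M N X : {set edge G}).
Implicit Types (K S T : {set vertex G}).

Definition nbr F S : {set vertex G} :=
  [set v in ~: A | [exists e in F, (v \in ends e) && (ends e :&: S != set0)]].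

Lemma nbrP F S v :
  reflect (v \notin A /\ exists e u, [/\ e \in F, v \in ends e, u \in ends e & u \in S])
    (v \in nbr F S).
Proof.
rewrite !inE; apply: (iffP andP) => -[vA].
  case/existsP => e /and3P[eF ve /set0Pn[u]]; rewrite inE => /andP[ue uS].
  by split=> //; exists e, u.
move=> [e [u [eF ve ue uS]]]; split=> //; apply/existsP; exists e.
by rewrite eF ve; apply/set0Pn; exists u; rewrite inE ue.
Qed.

Definition hall_condition F := [forall S : {set vertex G}, (S \subset A) ==> (#|S| <= #|nbr F S|)].

(* Rado's argument: in an inclusion-minimal edge set satisfying Hall's condition
   every vertex of [A] has degree 1, since two edges at the same vertex would
   give two violating sets whose union and intersection contradict the
   condition. *)
Lemma hall_perfect_matching F : #|A| = #|~: A| -> hall_condition F ->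
  exists2 M, perfect_matching M & M \subset F.
Proof.
move=> cardA hF; have [M /minsetP[hM minM] MF] := minset_exists (P := hall_condition) hF.
exists M => //; have hallM S : S \subset A -> #|S| <= #|nbr M S|.
  by move=> SA; have /forallP/(_ S)/implyP := hM; apply.
have viol e u : e \in M -> u \in ends e -> u \in A ->
    exists T, [/\ T \subset A, u \notin T & #|nbr (M :\ e) (u |: T)| <= #|T|].
  move=> eM ue uA; case: (boolP (hall_condition (M :\ e))) => [h|].
    by have := minM _ h (subD1set _ _) => E; move: eM; rewrite -E !inE eqxx.
  rewrite negb_forall => /existsP[S]; rewrite negb_imply -ltnNge => /andP[SA ltS].
  have uS : u \in S.
    apply/negPn/negP => uS; move: ltS; rewrite ltnNge => /negP[].
    apply: leq_trans (hallM S SA) _; apply: subset_leq_card.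
    apply/subsetP => v /nbrP[vA [e' [w [e'M ve' we' wS]]]]; apply/nbrP; split=> //.
    exists e', w; split=> //; rewrite !inE e'M andbT.
    apply/eqP => ee; move: we'; rewrite ee => we'.
    have := bip_mem bA ue we' uA; rewrite (subsetP SA _ wS) => /esym/eqP wu.
    by rewrite -wu wS in uS.
  exists (S :\ u); rewrite !inE eqxx /= setD1K //; split=> //.
    exact: subset_trans (subD1set _ _) SA.
  by rewrite (cardsD1 u S) uS in ltS.
have deg1 u : u \in A -> deg M u = 1.
  move=> uA; apply/eqP; rewrite eqn_leq; apply/andP; split; last first.
    have := hallM [set u]; rewrite sub1set cards1 => /(_ uA) /card_gt0P[v /nbrP[_ [e [w [eM _ we]]]]].
    by rewrite inE => /eqP wu; apply/deg_gt0P; exists e => //; rewrite -wu.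
  rewrite leqNgt; apply/negP => /card_gt1P[e1 [e2]]; rewrite !inE.
  case=> /andP[e1M u1] /andP[e2M u2] ne.
  have [T1 [T1A uT1 c1]] := viol e1 u e1M u1 uA.
  have [T2 [T2A uT2 c2]] := viol e2 u e2M u2 uA.
  have TA : u |: (T1 :|: T2) \subset A.
    by rewrite !subUset sub1set uA T1A T2A.
  have TI : T1 :&: T2 \subset A by apply: subset_trans (subsetIl _ _) T1A.
  have := hallM _ TA; have := hallM _ TI; rewrite cardsU1 inE negb_or uT1 uT2.
  set N1 := nbr (M :\ e1) (u |: T1) in c1; set N2 := nbr (M :\ e2) (u |: T2) in c2.
  have sI : nbr M (T1 :&: T2) \subset N1 :&: N2.
    apply/subsetP => v /nbrP[vA [e [w [eM ve we]]]]; rewrite inE => /andP[w1 w2].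
    have neu e' : u \in ends e' -> e != e'.
      move=> ue'; apply/eqP => ee; move: we; rewrite ee => we.
      have := bip_mem bA ue' we uA; rewrite (subsetP T1A _ w1) => /esym/eqP wu.
      by rewrite -wu w1 in uT1.
    rewrite inE; apply/andP; split; apply/nbrP; split=> //; exists e, w;
      by split=> //; rewrite !inE ?w1 ?w2 ?orbT // eM neu.
  have sU : nbr M (u |: (T1 :|: T2)) \subset N1 :|: N2.
    apply/subsetP => v /nbrP[vA [e [w [eM ve we wT]]]]; rewrite inE.
    have in1 : e != e1 -> w \in u |: T1 -> v \in N1.
      by move=> ee wT1; apply/nbrP; split=> //; exists e, w; split=> //; rewrite !inE ee.
    have in2 : e != e2 -> w \in u |: T2 -> v \in N2.
      by move=> ee wT2; apply/nbrP; split=> //; exists e, w; split=> //; rewrite !inE ee.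
    have wA := subsetP TA _ wT.
    have eu e' : u \in ends e' -> e = e' -> w = u.
      move=> ue' ee; move: we; rewrite ee => we.
      by have := bip_mem bA ue' we uA; rewrite wA => /esym/eqP.
    have [wu|wu] := eqVneq w u.
      have [ee|ee] := eqVneq e e1; last by rewrite in1 // wu !inE eqxx.
      by rewrite in2 ?orbT ?ee // wu !inE eqxx.
    move: wT; rewrite !in_setU in_set1 (negPf wu) /= => /orP[] wT.
      by rewrite in1 ?inE ?wT ?orbT //; apply: contraNneq wu => /(eu _ u1) ->.
    by rewrite in2 ?inE ?wT ?orbT //; apply: contraNneq wu => /(eu _ u2) ->.
  have := subset_leq_card sI; have := subset_leq_card sU.
  have := cardsUI N1 N2; have := cardsUI T1 T2; move: c1 c2; clear.
  clearbody N1 N2; clear; lia.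
have cardM : #|M| = #|A|.
  rewrite -(sum_deg_side bA M) (eq_bigr (fun=> 1)) ?sum_nat_const ?muln1 //.
have deg_pos v : v \notin A -> 0 < deg M v.
  move=> vA; have /eqP NA : nbr M A == ~: A.
    rewrite eqEcard -cardA hallM // andbT; apply/subsetP => w /nbrP[wA _].
    by rewrite inE.
  have : v \in nbr M A by rewrite NA inE.
  by case/nbrP => _ [e [w [eM ve _ _]]]; apply/deg_gt0P; exists e.
apply/forallP => v; case: (boolP (v \in A)) => [/deg1 -> //|vA].
have := sum_deg_side (bipartitionC bA) M; rewrite cardM cardA.
have vA' : v \in ~: A by rewrite inE.
rewrite (bigD1 v) //= (cardD1 v) vA'.
have : \sum_(i in ~: A | i != v) 1 <= \sum_(i in ~: A | i != v) deg M i.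
  by apply: leq_sum => i /andP[+ _]; rewrite inE; exact: deg_pos.
rewrite sum_nat_const muln1.
have -> : #|[pred i in ~: A | i != v]| = #|[predD1 ~: A & v]|.
  by apply: eq_card => i; rewrite !inE andbC.
have := deg_pos v vA; lia.
Qed.

Lemma card_ends_nbr F S e : S \subset A -> e \in F ->
  #|ends e :&: S| <= #|ends e :&: nbr F S|.
Proof.
move=> SA eF; have le1 : #|ends e :&: S| <= 1.
  by rewrite -(bA e) subset_leq_card // setIS.
case: (posnP #|ends e :&: S|) => [-> //|/card_gt0P[u]]; rewrite inE => /andP[ue uS].
apply: leq_trans le1 _; have [x [y [ee xA yA]]] := bip_ends bA e.
apply/card_gt0P; exists y; rewrite inE; apply/andP; split; first by rewrite ee !inE eqxx orbT.
by apply/nbrP; split=> //; exists e, u; split=> //; rewrite ee !inE eqxx orbT.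
Qed.

Lemma regular_perfect_matching r F : 0 < r -> regular r F ->
  exists2 M, perfect_matching M & M \subset F.
Proof.
move=> r0 rF; apply: hall_perfect_matching; first exact: bip_card r0 rF.
apply/forallP => S; apply/implyP => SA.
rewrite -(leq_pmul2l r0) -!(regular_sum _ rF) !handshake.
by apply: leq_sum => e; exact: card_ends_nbr.
Qed.

End Hall.

Section TwoFactors.

Variables (G : mgraph) (A : {set vertex G}).
Hypothesis bA : bipartition A.
Implicit Types (u v w : vertex G) (e : edge G) (F C M N X : {set edge G}).
Implicit Types (K S T : {set vertex G}).

Definition side_cut (B K : {set vertex G}) : {set edge G} :=
  [set e | (#|ends e :&: (K :&: B)| == 1) && (#|ends e :&: (K :&: ~: B)| == 0)].

Lemma card_ends_side e K :
  #|ends e :&: K| = #|ends e :&: (K :&: A)| + #|ends e :&: (K :&: ~: A)|.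
Proof. by rewrite -(cardsID A (ends e :&: K)) setDE !setIA. Qed.

Lemma card_ends_side1 (B : {set vertex G}) e K : bipartition B -> #|ends e :&: (K :&: B)| <= 1.
Proof. by move=> bB; rewrite -(bB e) subset_leq_card // setIS // subsetIr. Qed.

Lemma cut_sides K : cut K = side_cut A K :|: side_cut (~: A) K.
Proof.
apply/setP => e; rewrite !inE setCK card_ends_side.
by have := card_ends_side1 e K bA; have := card_ends_side1 e K (bipartitionC bA); lia.
Qed.

Lemma side_cut_disjoint K : [disjoint side_cut A K & side_cut (~: A) K].
Proof.
rewrite -setI_eq0; apply/eqP/setP => e; rewrite !inE setCK; lia.
Qed.

Lemma card_cutI F K : #|F :&: cut K| = #|F :&: side_cut A K| + #|F :&: side_cut (~: A) K|.
Proof.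
rewrite -cardsUI -setIUr -cut_sides -setIIr.
by have := side_cut_disjoint K; rewrite -setI_eq0 => /eqP ->; rewrite setI0 cards0 addn0.
Qed.

Lemma cut_balance r F K : regular r F ->
  r * #|K :&: A| + #|F :&: side_cut (~: A) K| =
  r * #|K :&: ~: A| + #|F :&: side_cut A K|.
Proof.
move=> rF; rewrite -!(regular_sum _ rF) !handshake.
rewrite !card_setI_sum -!big_split /=; apply: eq_bigr => e _; rewrite !inE setCK.
by have := card_ends_side1 e K bA; have := card_ends_side1 e K (bipartitionC bA); lia.
Qed.

Hypothesis cG : cubic G.

Lemma two_factorC M : perfect_matching M -> two_factor (~: M).
Proof. by move=> pM; have := regularD (subsetT M) pM cG; rewrite setTD. Qed.

Lemma perfect_matchingC F : two_factor F -> perfect_matching (~: F).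
Proof. by move=> pF; have := regularD (subsetT F) pF cG; rewrite setTD. Qed.

Lemma two_factor_diff F M : two_factor F -> perfect_matching M -> M \subset F ->
  perfect_matching (F :\: M).
Proof. by move=> tF pM MF; exact: regularD MF pM tF. Qed.

Lemma edge_in_perfect_matching e : exists2 M, perfect_matching M & e \in M.
Proof.
have [M1 p1 _] := regular_perfect_matching bA (isT : 0 < 3) cG.
have t1 := two_factorC p1.
have [M2 p2 M21] := regular_perfect_matching bA (isT : 0 < 2) t1.
have [e1|e1] := boolP (e \in M1); first by exists M1.
have [e2|e2] := boolP (e \in M2); first by exists M2.
by exists (~: M1 :\: M2); [exact: two_factor_diff | rewrite !inE e2].
Qed.

Lemma small_cut_avoiding_two_factor K : #|cut K| < 3 ->
  exists2 F, two_factor F & F :&: cut K = set0.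
Proof.
move=> ltK; have b3 := cut_balance K cG.
have := card_cutI setT K; move: b3; rewrite !setTI => b3 cK.
have [c0|cn0] := eqVneq (cut K) set0.
  have [M pM _] := regular_perfect_matching bA (isT : 0 < 3) cG.
  by exists (~: M); [exact: two_factorC | rewrite c0 setI0].
have /set0Pn[e eK] := cn0.
have [M pM eM] := edge_in_perfect_matching e.
have bM := cut_balance K pM; have cM := card_cutI M K.
have eMK : 0 < #|M :&: cut K| by apply/card_gt0P; exists e; rewrite inE eM.
have lA := subset_leq_card (subsetIr M (side_cut A K)).
have lB := subset_leq_card (subsetIr M (side_cut (~: A) K)).
exists (~: M); first exact: two_factorC.
rewrite setIC -setDE; apply/eqP; rewrite setD_eq0.
have /eqP <- : M :&: cut K == cut K by rewrite eqEcard subsetIr; lia.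
exact: subsetIl.
Qed.

Lemma cut_one_side K : #|cut K| = 3 ->
  side_cut A K = set0 \/ side_cut (~: A) K = set0.
Proof.
move=> K3; have := cut_balance K cG; have := card_cutI setT K; rewrite !setTI K3.
move=> h1 h2; have [|] : #|side_cut A K| = 0 \/ #|side_cut (~: A) K| = 0 by lia.
  by move/eqP; rewrite cards_eq0 => /eqP; left.
by move/eqP; rewrite cards_eq0 => /eqP; right.
Qed.

Lemma cut3_perfect_matching K M : #|cut K| = 3 -> perfect_matching M ->
  #|M :&: cut K| = 1.
Proof.
move=> K3 pM; have := cut_balance K cG; have := card_cutI setT K; rewrite !setTI K3.
have := cut_balance K pM; have := card_cutI M K.
have lA := subset_leq_card (subsetIr M (side_cut A K)).
have lB := subset_leq_card (subsetIr M (side_cut (~: A) K)).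
lia.
Qed.

Lemma cut3_two_factor K F : #|cut K| = 3 -> two_factor F -> #|F :&: cut K| = 2.
Proof.
move=> K3 tF; have := cut3_perfect_matching K3 (perfect_matchingC tF).
by have := cardsID F (cut K); rewrite K3 setDE ![cut K :&: _]setIC; lia.
Qed.

Lemma cut3_extend K X : #|cut K| = 3 -> X \subset cut K -> #|X| = 2 ->
  exists2 F, two_factor F & F :&: cut K = X.
Proof.
move=> K3 XK X2; have /card_gt0P[e] : 0 < #|cut K :\: X|.
  by have := cardsID X (cut K); rewrite (setIidPr XK); lia.
rewrite in_setD => /andP[eX eK].
have [M pM eM] := edge_in_perfect_matching e; have tM := two_factorC pM.
exists (~: M) => //; apply/esym/eqP; rewrite eqEcard (cut3_two_factor K3 tM) X2 leqnn andbT.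
apply/subsetP => f fX; rewrite in_setI in_setC (subsetP XK) // andbT.
have /eqP/cards1P[x hx] := cut3_perfect_matching K3 pM.
have : e \in M :&: cut K by rewrite in_setI eM.
rewrite hx inE => /eqP ex; apply/negP => fM.
have : f \in M :&: cut K by rewrite in_setI fM (subsetP XK).
by rewrite hx -ex inE => /eqP fe; rewrite -fe fX in eX.
Qed.

Hypothesis hamG : forall F, two_factor F -> spanning_connected F.

Lemma cut_ge3 K : K != set0 -> K != setT -> 3 <= #|cut K|.
Proof.
move=> K0 KT; rewrite leqNgt; apply/negP => /small_cut_avoiding_two_factor[F tF F0].
have /set0Pn[u uK] := K0.
have /set0Pn[v] : ~: K != set0 by apply: contraNneq KT => /(congr1 (@setC _)); rewrite setCK setC0 => ->.
rewrite inE => vK; have /spanning_connectedP/(_ K u v uK vK)[e eF eK] := hamG tF.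
have : e \in F :&: cut K by rewrite inE eF.
by rewrite F0 inE.
Qed.

End TwoFactors.

Section Extensions.

Variable G : mgraph.
Implicit Types (u v w : vertex G) (e : edge G) (F C H L M N X : {set edge G}).

Lemma pm_unique M e f v : perfect_matching M -> e \in M -> f \in M ->
  v \in ends e -> v \in ends f -> e = f.
Proof.
move=> /regularP/(_ v)/eqP/cards1P[x hx] eM fM ve vf.
have : e \in [set x] by rewrite -hx inE eM.
have : f \in [set x] by rewrite -hx inE fM.
by rewrite !inE => /eqP -> /eqP ->.
Qed.

Lemma ends_nonempty e : exists v, v \in ends e.
Proof. by apply/card_gt0P; rewrite card_ends. Qed.

Lemma pm_sub_eq M N : perfect_matching M -> perfect_matching N -> M \subset N -> M = N.
Proof.
move=> pM pN MN; apply/eqP; rewrite eqEsubset MN /= -setD_eq0; apply/eqP.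
by apply: deg_eq0; apply/regularP; exact: regularD MN pM pN.
Qed.

(* The vertices at which M and M' agree form a union of components of H. *)
Lemma pm_of_hamiltonian_cycle H M M' :
  hamiltonian_cycle H -> perfect_matching M -> perfect_matching M' ->
  M \subset H -> M' \subset H -> M' = M \/ M' = H :\: M.
Proof.
move=> /andP[tH cH] pM pM' MH M'H.
have pN : perfect_matching (H :\: M) := regularD MH pM tH.
have pN' : perfect_matching (H :\: M') := regularD M'H pM' tH.
pose S := [set v | [forall e, (v \in ends e) ==> ((e \in M) == (e \in M'))]].
have SP v : reflect (forall e, v \in ends e -> (e \in M) = (e \in M')) (v \in S).
  rewrite inE; apply: (iffP forallP) => h e; last by apply/implyP => /h ->.
  by move=> ve; have /implyP/(_ ve)/eqP := h e.
have commonS e v : e \in M -> e \in M' -> v \in ends e -> v \in S.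
  move=> eM eM' ve; apply/SP => f vf; apply/idP/idP => hf.
    by rewrite (pm_unique pM hf eM vf ve).
  by rewrite (pm_unique pM' hf eM' vf ve).
have avoidS e v : e \in H -> e \notin M -> e \notin M' -> v \in ends e -> v \in S.
  move=> eH eM eM' ve; have eN : e \in H :\: M by rewrite inE eM.
  have eN' : e \in H :\: M' by rewrite inE eM'.
  have key M1 f : perfect_matching (H :\: M1) -> M1 \subset H -> e \in H :\: M1 ->
      v \in ends f -> (f \in M1) = (f \in H) && (f != e).
    move=> p1 s1 e1 vf; apply/idP/andP => [f1|[fH fe]].
      split; first exact: (subsetP s1).
      by apply: contraTneq f1 => ->; move: e1; rewrite inE => /andP[].
    apply/negPn/negP => f1; move/eqP: fe; apply.
    by apply: pm_unique p1 _ e1 vf ve; rewrite inE f1.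
  by apply/SP => f vf; rewrite (key M f pN MH eN vf) (key M' f pN' M'H eN' vf).
have [S0|/set0Pn[u uS]] := eqVneq S set0.
  right; apply: pm_sub_eq => //; apply/subsetP => e eM'; rewrite inE (subsetP M'H) // andbT.
  apply/negP => eM; have [v ve] := ends_nonempty e.
  by have := commonS e v eM eM' ve; rewrite S0 inE.
left; apply/setP => e; have [v ve] := ends_nonempty e; apply/esym.
suff /SP : v \in S by apply.
apply/negPn/negP => vS.
have [f fH /cutP[x [y [xf yf xS]]]] := spanning_connectedP _ cH S u v uS vS.
have fMM' := SP _ xS _ xf; case/negP.
have [fM|fM] := boolP (f \in M); first by apply: (commonS f); rewrite -?fMM'.
by apply: (avoidS f); rewrite -?fMM'.
Qed.

Lemma pm_disjoint M N : perfect_matching M -> perfect_matching N ->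
  two_factor (M :|: N) -> [disjoint M & N].
Proof.
move=> /regularP pM /regularP pN /regularP pMN; rewrite -setI_eq0; apply/eqP.
by apply: deg_eq0 => v; have := deg_setUI M N v; rewrite pM pN pMN; lia.
Qed.

Lemma extends_setD M N : perfect_matching M -> extends_to_ham M N ->
  (M :|: N) :\: M = N /\ (M :|: N) :\: N = M.
Proof.
move=> pM /andP[pN /andP[tMN _]]; have := pm_disjoint pM pN tMN.
rewrite -setI_eq0 => /eqP d; split; apply/setP => e; have /setP/(_ e) := d;
  by rewrite !inE; do 2 case: (e \in _).
Qed.

Hypothesis cG : cubic G.

(* Every Hamiltonian cycle splits in two ways as an ordered pair of perfect
   matchings and is determined by its complement: if every perfect matching
   extends twice, there are as many Hamiltonian cycles as perfect matchings. *)
Lemma two_extensions_hamiltonian :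
  (forall M, perfect_matching M -> 2 <= #|[set N | extends_to_ham M N]|) ->
  forall L, perfect_matching L -> hamiltonian_cycle (~: L).
Proof.
move=> ext2.
pose PM := [set M : {set edge G} | perfect_matching M].
pose HM := [set L in PM | hamiltonian_cycle (~: L)].
pose P := [set p : {set edge G} * {set edge G} | perfect_matching p.1 && extends_to_ham p.1 p.2].
have lower : 2 * #|PM| <= #|P|.
  have -> : #|P| = \sum_(M in PM) #|[set N | extends_to_ham M N]|.
    rewrite -sum1_card; under [RHS]eq_bigr do rewrite -sum1_card.
    rewrite pair_big_dep; apply: eq_bigl => p; by rewrite !inE.
  rewrite mulnC -sum_nat_const; apply: leq_sum => M; rewrite inE; exact: ext2.
pose phi (p : {set edge G} * {set edge G}) := ~: (p.1 :|: p.2).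
have phiHM p : p \in P -> phi p \in HM.
  rewrite inE => /andP[p1 /andP[p2 h12]]; rewrite !inE /phi setCK h12 andbT.
  by apply: perfect_matchingC => //; case/andP: h12.
have fibre L : L \in HM -> #|[set p in P | phi p == L]| <= 2.
  move=> _; have [->|/set0Pn[[M N]]] := eqVneq [set p in P | phi p == L] set0.
    by rewrite cards0.
  rewrite inE [_ \in P]inE /= => /andP[/andP[pM eMN] /eqP hL].
  apply: leq_trans (_ : #|[set (M, N); (N, M)]| <= 2); last by rewrite cards2; case: (_ == _).
  apply: subset_leq_card; apply/subsetP => -[M' N'].
  rewrite inE [_ \in P]inE /= => /andP[/andP[pM' eMN'] /eqP hL'].
  have E : M' :|: N' = M :|: N by apply: setC_inj; rewrite -[LHS]/(phi (M', N')) hL' -hL.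
  have [d1 d2] := extends_setD pM eMN; have [d1' _] := extends_setD pM' eMN'.
  have /andP[_ hMN] := eMN; rewrite !inE !xpair_eqE.
  have [||h|h] := pm_of_hamiltonian_cycle hMN pM pM'.
  - exact: subsetUl.
  - by rewrite -E subsetUl.
  - by rewrite -d1' E h d1 !eqxx.
  by rewrite -d1' E h d1 d2 !eqxx orbT.
have upper : #|P| <= 2 * #|HM|.
  rewrite -sum1_card (partition_big phi (mem HM)) //=.
  rewrite mulnC -sum_nat_const; apply: leq_sum => L LH.
  apply: leq_trans (fibre L LH); rewrite -sum1_card.
  by apply/eq_leq/eq_bigl => p; rewrite [RHS]inE.
have /eqP E : HM == PM.
  rewrite eqEcard; apply/andP; split; last lia.
  by apply/subsetP => L; rewrite inE => /andP[].
move=> L pL; have : L \in HM by rewrite E inE.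
by rewrite inE => /andP[].
Qed.

Lemma two_extensions_2FH : PMH G ->
  (forall M, perfect_matching M -> ~ exists! N, extends_to_ham M N) ->
  two_factor_hamiltonian G.
Proof.
move=> [[M0 pM0] ext] nouniq.
have ham : forall L, perfect_matching L -> hamiltonian_cycle (~: L).
  apply: two_extensions_hamiltonian => M pM; rewrite ltnNge; apply/negP => le1.
  have [N eN] := ext M pM; case: (nouniq M pM); exists N; split=> // N' eN'.
  apply/(card_le1_eqP le1); by rewrite inE.
split; first by exists (~: M0); exact: ham.
by move=> F tF; rewrite -(setCK F); apply/ham/perfect_matchingC.
Qed.

Variable A : {set vertex G}.
Hypothesis bA : bipartition A.
Hypothesis hamG : forall F, two_factor F -> spanning_connected F.

Lemma extends_in_complement M N : perfect_matching M -> perfect_matching N ->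
  N \subset ~: M -> extends_to_ham M N.
Proof.
move=> pM pN NM; have tMN : two_factor (M :|: N).
  by apply: (@regularU _ 1 1) => //; rewrite disjoint_sym disjoints_subset.
by rewrite /extends_to_ham pN /hamiltonian_cycle tMN hamG.
Qed.

Lemma hamiltonian_PMH : PMH G.
Proof.
have [M0 p0 _] := regular_perfect_matching bA (isT : 0 < 3) cG.
split; first by exists M0.
move=> M pM; have [N pN NM] := regular_perfect_matching bA (isT : 0 < 2) (two_factorC cG pM).
by exists N; exact: extends_in_complement.
Qed.

Lemma hamiltonian_extension_not_unique v M : perfect_matching M ->
  ~ exists! N, extends_to_ham M N.
Proof.
move=> pM [N [eN uniqN]]; have /andP[pN /andP[tMN _]] := eN.
have pN' : perfect_matching (~: (M :|: N)) by exact: perfect_matchingC.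
have := uniqN _ (extends_in_complement pM pN' _).
rewrite setCS subsetUl => /(_ isT) E.
have /deg_gt0P[e eN1 _] : 0 < deg N v by have /regularP -> := pN.
by have := eN1; rewrite {1}E !inE eN1 orbT.
Qed.

End Extensions.

Section Contraction.

Variables (G : mgraph) (K : {set vertex G}).
Implicit Types (u v w : vertex G) (e : edge G) (F C H L M N X : {set edge G}).

Definition touches e : bool := ends e :&: K != set0.

Definition contract_vertex : finType := option {x : vertex G | x \in K}.

Definition contract_edge : finType := {e : edge G | touches e}.

Definition proj (x : vertex G) : contract_vertex := insub x.

Definition contract_ends (e : contract_edge) : {set contract_vertex} :=
  proj @: ends (val e).

Lemma proj_eq_None x : (proj x == None) = (x \notin K).
Proof. by rewrite /proj; case: insubP => [y -> _|/negPf ->]. Qed.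

Lemma proj_inj x y : x \in K -> proj x = proj y -> x = y.
Proof.
rewrite /proj => xK; rewrite (insubT (mem K) xK).
by case: insubP => // z _ <- [<-].
Qed.

Lemma ends_other e x : x \in ends e -> exists2 y, y != x & ends e = [set x; y].
Proof.
move=> xe; have : 0 < #|ends e :\ x|.
  by have := cardsD1 x (ends e); rewrite xe card_ends; lia.
case/card_gt0P => y; rewrite !inE => /andP[yx ye]; exists y => //.
by apply: ends2 => //; rewrite eq_sym.
Qed.

Lemma card_contract_ends (e : contract_edge) : #|contract_ends e| = 2.
Proof.
case: e => e /=; rewrite /contract_ends /= => /set0Pn[x]; rewrite inE => /andP[xe xK].
have [y yx ->] := ends_other xe.
rewrite imsetU1 imset_set1 cards2; apply/eqP; rewrite eqSS eqb1.
by apply: contra yx => /eqP/(proj_inj xK) ->.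
Qed.

Definition contract : mgraph := MGraph card_contract_ends.

Implicit Types (D : {set edge contract}) (a : vertex contract).

Lemma Some_in_contract_ends (e : edge contract) (x : {x : vertex G | x \in K}) :
  ((Some x : vertex contract) \in ends e) = (val x \in ends (val e)).
Proof.
apply/imsetP/idP => [[y ye]|xe]; last by exists (val x); rewrite // /proj valK.
by rewrite /proj; case: insubP => // z _ zy [->]; rewrite zy.
Qed.

Lemma None_in_contract_ends (e : edge contract) :
  ((None : vertex contract) \in ends e) = ~~ (ends (val e) \subset K).
Proof.
apply/imsetP/subsetPn => [[y ye /esym/eqP]|[y ye yK]].
  by rewrite proj_eq_None; exists y.
by exists y => //; apply/esym/eqP; rewrite proj_eq_None.
Qed.

Lemma cut_touches e : e \in cut K = touches e && ~~ (ends e \subset K).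
Proof.
apply/cutP/andP => [[u [v [ue ve uK vK]]]|[/set0Pn[u]]].
  by split; [apply/set0Pn; exists u; rewrite inE ue | apply/subsetPn; exists v].
by rewrite inE => /andP[ue uK] /subsetPn[v ve vK]; exists u, v.
Qed.

Definition lift_edges D : {set edge G} := [set val e | e in D].

Definition restr F : {set edge contract} := [set e | val e \in F].

Lemma mem_lift_edges D (e : edge contract) : (val e \in lift_edges D) = (e \in D).
Proof. by rewrite mem_imset //; exact: val_inj. Qed.

Lemma lift_edges_touches D e : e \in lift_edges D -> touches e.
Proof. by case/imsetP => f _ ->; exact: valP. Qed.

Lemma deg_contract_Some D x : deg D (Some x : vertex contract) = deg (lift_edges D) (val x).
Proof.
rewrite /deg -(card_imset _ val_inj); apply: eq_card => e; rewrite inE.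
apply/imsetP/andP => [[f]|[/imsetP[f fD ->] xf]].
  by rewrite inE Some_in_contract_ends => /andP[fD xf] ->; rewrite mem_lift_edges.
by exists f => //; rewrite inE fD Some_in_contract_ends.
Qed.

Lemma deg_contract_None D : deg D (None : vertex contract) = #|lift_edges D :&: cut K|.
Proof.
rewrite /deg -(card_imset _ val_inj); apply: eq_card => e; rewrite in_setI cut_touches.
apply/imsetP/and3P => [[f]|[/imsetP[f fD ->] tf Kf]].
  by rewrite inE None_in_contract_ends => /andP[fD xf] ->; rewrite mem_lift_edges (valP f).
by exists f => //; rewrite inE fD None_in_contract_ends.
Qed.

Lemma lift_edges_restr F : lift_edges (restr F) = F :&: [set e | touches e].
Proof.
apply/setP => e; apply/imsetP/idP => [[f]|]; rewrite !inE.
  by move=> fF ->; rewrite fF (valP f).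
by case/andP=> eF te; exists (Sub e te); rewrite ?inE.
Qed.

Lemma deg_touches F (x : vertex G) : x \in K -> deg (F :&: [set e | touches e]) x = deg F x.
Proof.
move=> xK; apply: eq_card => e; rewrite !inE -andbA; apply: andb_id2l => eF.
by apply: andb_idl => xe; apply/set0Pn; exists x; rewrite inE xe.
Qed.

Lemma cut_sub_touches F : F :&: [set e | touches e] :&: cut K = F :&: cut K.
Proof.
by apply/setP => e; rewrite !in_setI cut_touches inE; case: touches; rewrite ?andbT ?andbF.
Qed.

Lemma restr_regular r F : regular r F -> #|F :&: cut K| = r -> regular r (restr F).
Proof.
move=> /regularP rF cF; apply/regularP => -[x|].
  by rewrite deg_contract_Some lift_edges_restr deg_touches ?rF // (valP x).
by rewrite deg_contract_None lift_edges_restr cut_sub_touches.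
Qed.

Lemma restr_spanning_connected F : K != setT -> spanning_connected F ->
  spanning_connected (restr F).
Proof.
move=> KT /spanning_connectedP cF; apply/spanning_connectedP => S a b aS bS.
have surj c : exists x, proj x = c.
  case: c => [x|]; first by exists (val x); rewrite /proj valK.
  have /subsetPn[x _ xK] : ~~ (setT \subset K).
    by apply: contra KT; rewrite -subTset.
  by exists x; apply/eqP; rewrite proj_eq_None.
have [x xa] := surj a; have [y yb] := surj b.
have [||e eF /cutP[u [v [ue ve]]]] := cF [set z | proj z \in S] x y.
- by rewrite inE xa.
- by rewrite inE yb.
rewrite !inE => uS vS.
have te : touches e.
  apply/negP => /eqP e0.
  have notK w : w \in ends e -> proj w = None.
    move=> we; apply/eqP; rewrite proj_eq_None; apply/negP => wK.
    have : w \in ends e :&: K by rewrite inE we.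
    by rewrite e0 inE.
  by move: vS; rewrite (notK v ve) -(notK u ue) uS.
exists (Sub e te : edge contract); first by rewrite inE.
by apply/cutP; exists (proj u), (proj v); split=> //; apply: imset_f.
Qed.

Lemma contract_two_factor_extension D F : two_factor D -> two_factor F ->
  F :&: cut K = lift_edges D :&: cut K ->
  exists2 H, two_factor H & restr H = D.
Proof.
move=> /regularP tD /regularP tF FD.
pose H := lift_edges D :|: (F :\: [set e | touches e]); exists H; last first.
  by apply/setP => e; rewrite !inE mem_lift_edges (valP e) orbF.
apply/regularP => x; have [xK|xK] := boolP (x \in K).
  rewrite -(tD (Some (Sub x xK))) deg_contract_Some; apply: eq_card => e; rewrite !inE.
  apply: andb_id2r => xe; rewrite -[RHS]orbF; congr (_ || _).
  by rewrite /touches; have -> : ends e :&: K != set0 by apply/set0Pn; exists x; rewrite inE xe.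
rewrite -(tF x); apply: eq_card => e; rewrite !inE; apply: andb_id2r => xe.
have [te|te] := boolP (touches e); last first.
  by rewrite orb_idl // => /lift_edges_touches; rewrite (negPf te).
have ec : e \in cut K by rewrite cut_touches te; apply/subsetPn; exists x.
by rewrite andFb orbF; have /setP/(_ e) := FD; rewrite !in_setI ec !andbT.
Qed.

Lemma contract_bipartite (A : {set vertex G}) : bipartition A ->
  side_cut (~: A) K = set0 -> bipartite contract.
Proof.
move=> bA s0; exists [set a : vertex contract | if a is Some x then val x \in A else false] => e.
have [u [v [ee uA vA]]] := bip_ends bA (val e).
have -> : ends e = [set proj u; proj v].
  by rewrite -[LHS]/(proj @: ends (val e)) ee imsetU1 imset_set1.
have uK : u \in K.
  apply/negPn/negP => uK; have : val e \in side_cut (~: A) K.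
    rewrite inE setCK; have := valP e; rewrite /touches ee => /set0Pn[w].
    rewrite !inE => /andP[/orP[]/eqP -> wK]; first by rewrite wK in uK.
    apply/andP; split.
      rewrite (_ : _ :&: _ = [set v]) ?cards1 //; apply/setP => x; rewrite !inE.
      have [->|] := eqVneq x u; first by rewrite uA andbF; case: eqVneq vA => // <-; rewrite uA.
      by have [->|] := eqVneq x v; rewrite //= wK vA.
    rewrite cards_eq0; apply/eqP/setP => x; rewrite !inE.
    have [->|] := eqVneq x u; first by rewrite (negPf uK).
    by have [->|//] := eqVneq x v; rewrite (negPf vA) andbF.
  by rewrite s0 inE.
have vA' : (if proj v is Some x then val x \in A else false) = false.
  by rewrite /proj; case: insubP => // x _ ->; exact: negPf.
have uA' : (if proj u is Some x then val x \in A else false) = true.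
  by rewrite /proj; case: insubP => [x _ -> //|]; rewrite uK.
apply/eqP/cards1P; exists (proj u); apply/setP => a; rewrite !inE.
have [->|] := eqVneq a (proj u); first by rewrite uA'.
by have [->|] := eqVneq a (proj v); rewrite //= vA'.
Qed.

Lemma card_contract : #|vertex contract| = #|K|.+1.
Proof. by rewrite card_option card_sig. Qed.

Lemma contract_2FH (A : {set vertex G}) : bipartition A -> cubic G ->
  (forall F, two_factor F -> spanning_connected F) ->
  #|cut K| = 3 -> K != setT -> 
  [/\ cubic contract, connected contract & two_factor_hamiltonian contract].
Proof.
move=> bA cG hamG K3 KT.
have c1 : cubic contract.
  have -> : cubic contract = regular 3 (restr setT).
    by rewrite (_ : restr setT = setT) //; apply/setP => e; rewrite !inE.
  by apply: restr_regular; rewrite ?setTI.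
have [M pM _] := regular_perfect_matching bA (isT : 0 < 3) cG.
have t2 F : two_factor F -> hamiltonian_cycle (restr F).
  move=> tF; apply/andP; split; last exact: restr_spanning_connected (hamG _ tF).
  by apply: restr_regular => //; exact: cut3_two_factor K3 tF.
have tM := two_factorC cG pM.
split=> //.
  apply/andP; split; first by rewrite card_contract.
  have /andP[_ /spanning_connectedP h] := t2 _ tM; apply/spanning_connectedP => S u v uS vS.
  by have [e _ eS] := h S u v uS vS; exists e.
split; first by exists (restr (~: M)); exact: t2.
move=> D tD; have [||F tF FD] := @cut3_extend _ _ bA cG K (lift_edges D :&: cut K) K3.
- exact: subsetIr.
- by rewrite -deg_contract_None; apply/regularP.
have [H tH <-] := contract_two_factor_extension tD tF FD; exact: t2.
Qed.

End Contraction.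

Lemma inj_surj_bij (S T : finType) (f : S -> T) : injective f ->
  (forall y, exists x, f x = y) -> bijective f.
Proof.
move=> f_inj f_surj; apply: inj_card_bij => //; rewrite -(card_codom f_inj).
by apply/subset_leq_card/subsetP => y _; have [x <-] := f_surj y; exact: codom_f.
Qed.

Section StarDecomposition.

Variables (G : mgraph) (K : {set vertex G}).
Hypotheses (K3 : #|cut K| = 3) (cG : cubic G).

Lemma star_decomposition : star_product (contract K) (contract (~: K)) G.
Proof.
pose c (i : 'I_3) : edge G := enum_val (cast_ord (esym K3) i).
have cK i : c i \in cut K by exact: enum_valP.
have c_inj : injective c by move=> i j /enum_val_inj/cast_ord_inj.
have c_surj e : e \in cut K -> exists i, c i = e.
  move=> eK; exists (cast_ord K3 (enum_rank_in eK e)).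
  by rewrite /c cast_ordK enum_rankK_in.
have tK i : touches K (c i) by have := cK i; rewrite cut_touches => /andP[].
have tKC i : touches (~: K) (c i) by have := cK i; rewrite -cutC cut_touches => /andP[].
pose a i : edge (contract K) := Sub (c i) (tK i).
pose b i : edge (contract (~: K)) := Sub (c i) (tKC i).
have av i : (None : vertex (contract K)) \in ends (a i).
  by rewrite None_in_contract_ends; have := cK i; rewrite cut_touches => /andP[].
have bv i : (None : vertex (contract (~: K))) \in ends (b i).
  by rewrite None_in_contract_ends; have := cK i; rewrite -cutC cut_touches => /andP[].
exists None, None, a, b, av, bv; split.
- rewrite deg_contract_None -[RHS]K3; congr #|pred_of_set _|; apply/setIidPr/subsetP => e eK.
  have te : touches K e by move: eK; rewrite cut_touches => /andP[].
  by rewrite -[e]/(val (Sub e te : edge (contract K))) mem_lift_edges.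
- rewrite deg_contract_None -[RHS]K3 cutC; congr #|pred_of_set _|; apply/setIidPr/subsetP => e eK.
  have te : touches (~: K) e by move: eK; rewrite -cutC cut_touches => /andP[].
  by rewrite -[e]/(val (Sub e te : edge (contract (~: K)))) mem_lift_edges.
- by move=> i j /(congr1 val) /c_inj.
- by move=> i j /(congr1 val) /c_inj.
have [v0 _] : exists v, v \in ends (c ord0) by exact: ends_nonempty.
pose f (w : vertex (star_graph av bv)) : vertex G := match w with
  | inl x => if val x is Some y then val y else v0
  | inr x => if val x is Some y then val y else v0
  end.
pose g (e : edge (star_graph av bv)) : edge G := match e with
  | inl (inl e1) => val (val e1)
  | inl (inr e2) => val (val e2)
  | inr i => c i
  end.
have fl (x : {x : vertex (contract K) | x != None}) : f (inl x) \in K.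
  by case: x => -[y|] //= _; exact: valP.
have fr (x : {x : vertex (contract (~: K)) | x != None}) : f (inr x) \notin K.
  by case: x => -[y|] //= _; have := valP y; rewrite inE.
have f_inj : injective f.
  move=> [x|x] [y|y] E.
  - by move: E; case: x y => -[x|] //= ? [[y|] //= ?] /val_inj E; congr inl; apply: val_inj; rewrite /= E.
  - by have := fl x; rewrite E (negPf (fr y)).
  - by have := fl y; rewrite -E (negPf (fr x)).
  by move: E; case: x y => -[x|] //= ? [[y|] //= ?] /val_inj E; congr inr; apply: val_inj; rewrite /= E.
have f_surj v : exists w, f w = v.
  have [vK|vK] := boolP (v \in K).
    by exists (inl (Sub (Some (Sub v vK)) isT)).
  have vK' : v \in ~: K by rewrite inE.
  by exists (inr (Sub (Some (Sub v vK')) isT)).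
have gl (e : {e : edge (contract K) | None \notin ends e}) : ends (g (inl (inl e))) \subset K.
  by have := valP e; rewrite None_in_contract_ends negbK.
have gr (e : {e : edge (contract (~: K)) | None \notin ends e}) : ends (g (inl (inr e))) \subset ~: K.
  by have := valP e; rewrite None_in_contract_ends negbK.
have gc i : ~~ (ends (g (inr i)) \subset K) /\ ~~ (ends (g (inr i)) \subset ~: K).
  by have := cK i; split; [move: (cK i) | move: (cK i); rewrite -cutC];
    rewrite cut_touches => /andP[].
have excl e : ends e \subset K -> ends e \subset ~: K -> False.
  have [v ve] := ends_nonempty e; move=> /subsetP/(_ v ve) vK /subsetP/(_ v ve).
  by rewrite inE vK.
have g_inj : injective g.
  move=> [[e1|e1]|i] [[e2|e2]|j] E.
  - by do 2 congr inl; do 2 apply: val_inj.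
  - by case: (excl (g (inl (inl e1)))) => //; rewrite E.
  - by have := gl e1; rewrite E (negPf (gc j).1).
  - by case: (excl (g (inl (inr e1)))) => //; rewrite E.
  - by congr (inl (inr _)); do 2 apply: val_inj.
  - by have := gr e1; rewrite E (negPf (gc j).2).
  - by have := gl e2; rewrite -E (negPf (gc i).1).
  - by have := gr e2; rewrite -E (negPf (gc i).2).
  by congr inr; apply: c_inj.
have g_surj e : exists e', g e' = e.
  have [/c_surj[i <-]|] := boolP (e \in cut K); first by exists (inr i).
  rewrite cut_touches negb_and negbK; have [te /= eK|nte _] := boolP (touches K e).
    have h : (None : vertex (contract K)) \notin ends (Sub e te : edge (contract K)).
      by rewrite None_in_contract_ends negbK.
    by exists (inl (inl (Sub (Sub e te) h))).
  have eK : ends e \subset ~: K.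
    by move: nte; rewrite /touches negbK setI_eq0 disjoints_subset.
  have te : touches (~: K) e.
    have [v ve] := ends_nonempty e; apply/set0Pn; exists v; rewrite in_setI ve.
    exact: (subsetP eK).
  have h : (None : vertex (contract (~: K))) \notin ends (Sub e te : edge (contract (~: K))).
    by rewrite None_in_contract_ends negbK.
  by exists (inl (inr (Sub (Sub e te) h))).
exists f, g; split; [exact: inj_surj_bij | exact: inj_surj_bij | move=> e].
apply/esym/eqP; rewrite eqEcard card_imset // !card_ends leqnn andbT.
apply/subsetP => _ /imsetP[w we ->]; move: we.
case: e => [[e|e]|i]; case: w => [[[x|] //= ?]|[[x|] //= ?]]; rewrite inE //=;
  by rewrite Some_in_contract_ends.
Qed.

End StarDecomposition.

Section Inside.

Variable G : mgraph.
Implicit Types (u v w : vertex G) (e : edge G) (F C H L M N X : {set edge G}).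
Implicit Types (K S T : {set vertex G}).

Definition inside K : {set edge G} := [set e | ends e \subset K].

Lemma regular_cut_inside r F K : regular r F ->
  r * #|K| = #|F :&: cut K| + 2 * #|F :&: inside K|.
Proof.
move=> rF; rewrite -(regular_sum _ rF) handshake !card_setI_sum big_distrr -big_split /=.
apply: eq_bigr => e _; rewrite !inE.
have -> : (ends e \subset K) = (#|ends e :&: K| == 2).
  apply/setIidPl/eqP => [->|h]; first exact: card_ends.
  by apply/eqP; rewrite eqEcard subsetIl h card_ends.
have := subset_leq_card (subsetIl (ends e) K); rewrite card_ends.
by case: #|_| => [|[|[]]].
Qed.

Lemma sum_deg_touches (B : {set vertex G}) F T : bipartition B -> T \subset B ->
  \sum_(v in T) deg F v = #|F :&: [set e | touches T e]|.
Proof.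
move=> bB TB; rewrite handshake -sum1_card.
rewrite [RHS](eq_bigl (fun e => (e \in F) && touches T e)); last first.
  by move=> e; rewrite !inE.
rewrite big_mkcondr; apply: eq_bigr => e _.
have : #|ends e :&: T| <= 1 by rewrite -(bB e) subset_leq_card // setIS.
by rewrite /touches -card_gt0; case: #|_| => [|[]].
Qed.

Lemma touchesP K e : reflect (exists2 v, v \in ends e & v \in K) (touches K e).
Proof.
rewrite /touches; apply: (iffP (set0Pn _)) => [[v]|[v ve vK]]; last by exists v; rewrite inE ve.
by rewrite inE => /andP[]; exists v.
Qed.

Lemma adj_sym F : symmetric (adj F).
Proof. by move=> u v; rewrite /adj /=; apply: eq_existsb => e; rewrite setUC. Qed.

Lemma cycle_connected C u v : cycle_set C -> u \in cov C -> v \in cov C -> connect (adj C) u v.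
Proof.
by case/and3P => _ _ /forallP/(_ u)/forallP/(_ v)/implyP h; rewrite !inE => uC vC; rewrite h ?uC.
Qed.

Lemma cycle_deg C v : cycle_set C -> v \in cov C -> deg C v = 2.
Proof.
by case/and3P => _ /forallP/(_ v) + _; rewrite inE => /orP[/eqP ->|/eqP].
Qed.

Lemma mem_cov C e v : e \in C -> v \in ends e -> v \in cov C.
Proof. by move=> eC ve; rewrite inE; apply/deg_gt0P; exists e. Qed.

Lemma cycle_side_card (B : {set vertex G}) C : bipartition B -> cycle_set C ->
  #|C| = 2 * #|cov C :&: B|.
Proof.
move=> bB cC; rewrite -(sum_deg_side bB C) mulnC -sum_nat_const.
rewrite [RHS](eq_bigl (fun v => (v \in B) && (v \in cov C))); last first.
  by move=> v; rewrite inE andbC.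
rewrite big_mkcondr; apply: eq_bigr => v _; case: ifP => [/(cycle_deg cC) //|].
by rewrite inE; case: posnP.
Qed.

End Inside.

Section Irreducible.

Variables (G : mgraph) (A : {set vertex G}).
Hypotheses (bA : bipartition A) (cG : cubic G).
Hypothesis hamG : forall F : {set edge G}, two_factor F -> spanning_connected F.
Implicit Types (u v w : vertex G) (e : edge G) (F C H L M N X : {set edge G}).
Implicit Types (K S T : {set vertex G}).

Lemma card_side : #|A| = #|~: A|.
Proof. exact: bip_card bA (isT : 0 < 3) cG. Qed.

Lemma card_vertices : #|vertex G| = 2 * #|A|.
Proof. by rewrite -(cardsC A) -card_side addnn mul2n. Qed.

Lemma cut_inside K : 3 * #|K| = #|cut K| + 2 * #|inside K|.
Proof. by rewrite (regular_cut_inside K cG) !setTI. Qed.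

Lemma neq_setT K : #|K| < #|vertex G| -> K != setT.
Proof. by move=> h; apply: contraTneq h => ->; rewrite cardsT ltnn. Qed.

Section Simple.

Hypothesis V2 : 2 < #|vertex G|.

Definition parallel_edges u v : {set edge G} := [set e | ends e == [set u; v]].

Lemma card_parallel_edges u v : u != v -> #|parallel_edges u v| <= 1.
Proof.
move=> uv; have c2 : #|[set u; v]| = 2 by rewrite cards2 uv.
have := cut_inside [set u; v]; rewrite c2.
have le : #|parallel_edges u v| <= #|inside [set u; v]|.
  by apply/subset_leq_card/subsetP => e; rewrite !inE => /eqP ->.
have : 3 <= #|cut [set u; v]|.
  apply: (cut_ge3 bA) => //; first by rewrite -card_gt0 c2.
  by apply: neq_setT; rewrite c2.
lia.
Qed.

Lemma sum_parallel_edges u : u \in A -> \sum_(v in ~: A) #|parallel_edges u v| = 3.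
Proof.
move=> uA; have /regularP/(_ u) <- := cG; rewrite degE.
rewrite (eq_bigr (fun v => \sum_e (ends e == [set u; v]))); last first.
  move=> v _; rewrite -sum1_card big_mkcond /=; apply: eq_bigr => e _.
  by rewrite inE; case: eqP.
rewrite exchange_big [RHS](eq_bigl xpredT) /=; last by move=> e; rewrite inE.
apply: eq_bigr => e _; have [x [y [ee xA yA]]] := bip_ends bA e.
have [xu|xu] := eqVneq x u.
  rewrite ee -xu (bigD1 y) ?inE //= ?inE ?eqxx big1 // => z /andP[zA zy].
  apply/eqP; rewrite eqb0; apply: contra zy => /eqP/setP/(_ z); rewrite !inE eqxx orbT.
  by case/orP => // /eqP zx; rewrite ?inE zx xA in zA.
have -> : (u \in ends e) = false.
  by rewrite ee !inE eq_sym (negPf xu); apply: contraNF yA => /eqP <-.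
rewrite big1 // => z zA; apply/eqP; rewrite eqb0; apply: contra xu => /eqP exz.
have : x \in [set u; z] by rewrite -exz ee !inE eqxx.
rewrite !inE => /orP[//|/eqP xz]; by rewrite inE -xz xA in zA.
Qed.

Lemma A_nonempty : exists u, u \in A.
Proof. by apply/card_gt0P; move: V2; rewrite card_vertices; lia. Qed.

Lemma neq_sides u v : u \in A -> v \in ~: A -> u != v.
Proof. by move=> uA; rewrite inE; apply: contraNneq => <-. Qed.

Lemma card_side_ge3 : 3 <= #|A|.
Proof.
have [u uA] := A_nonempty; rewrite card_side -(sum_parallel_edges uA) -sum1_card.
by apply: leq_sum => v vA; apply/card_parallel_edges/neq_sides.
Qed.

Lemma K33_of_card6 : #|vertex G| = 6 -> isomorphic K33 G.
Proof.
move=> V6; have A3 : #|A| = 3 by move: V6; rewrite card_vertices; lia.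
have B3 : #|~: A| = 3 by rewrite -card_side.
have par u v : u \in A -> v \in ~: A -> exists e, ends e == [set u; v].
  move=> uA vA; have := sum_parallel_edges uA; rewrite (bigD1 v) //=.
  have : \sum_(i in ~: A | i != v) #|parallel_edges u i| <= \sum_(i in ~: A | i != v) 1.
    by apply: leq_sum => i /andP[iA _]; apply/card_parallel_edges/neq_sides.
  have := B3; rewrite -sum1_card (bigD1 v) //= => h1 h2 h3.
  have /card_gt0P[e] : 0 < #|parallel_edges u v| by lia.
  by rewrite inE; exists e.
pose fa (i : 'I_3) : vertex G := enum_val (cast_ord (esym A3) i).
pose fb (i : 'I_3) : vertex G := enum_val (cast_ord (esym B3) i).
have faA i : fa i \in A by exact: enum_valP.
have fbA i : fb i \in ~: A by exact: enum_valP.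
have fa_inj : injective fa by move=> i j /enum_val_inj/cast_ord_inj.
have fb_inj : injective fb by move=> i j /enum_val_inj/cast_ord_inj.
have fa_surj v : v \in A -> exists i, fa i = v.
  by move=> vA; exists (cast_ord A3 (enum_rank_in vA v)); rewrite /fa cast_ordK enum_rankK_in.
have fb_surj v : v \in ~: A -> exists i, fb i = v.
  by move=> vA; exists (cast_ord B3 (enum_rank_in vA v)); rewrite /fb cast_ordK enum_rankK_in.
pose f (x : vertex K33) : vertex G := match x with inl i => fa i | inr i => fb i end.
pose g (p : edge K33) : edge G := xchoose (par _ _ (faA (val p).1) (fbA (val p).2)).
have gP p : ends (g p) = [set fa (val p).1; fb (val p).2].
  by apply/eqP; exact: (xchooseP (par _ _ (faA (val p).1) (fbA (val p).2))).
have f_inj : injective f.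
  move=> [i|i] [j|j] /= E; first by rewrite (fa_inj _ _ E).
  - by have := fbA j; rewrite -E inE faA.
  - by have := fbA i; rewrite E inE faA.
  by rewrite (fb_inj _ _ E).
exists f, g; split.
- apply: inj_surj_bij => // v; have [/fa_surj[i <-]|vA] := boolP (v \in A).
    by exists (inl i).
  by have [i <-] : exists i, fb i = v; [apply: fb_surj; rewrite inE | exists (inr i)].
- apply: inj_surj_bij => [p q pq|e].
    have := gP p; rewrite pq gP => E; apply: val_inj; move: E.
    case: (val p) => i j; case: (val q) => i' j' /= E.
    have : fa i \in [set fa i'; fb j'] by rewrite E !inE eqxx.
    rewrite !inE => /orP[/eqP/fa_inj ->|/eqP h]; last by have := fbA j'; rewrite -h inE faA.
    have : fb j \in [set fa i'; fb j'] by rewrite E !inE eqxx orbT.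
    by rewrite !inE => /orP[/eqP h|/eqP/fb_inj -> //]; have := fbA j; rewrite h inE faA.
  have [u [v [ee uA vA]]] := bip_ends bA e.
  have [i iu] := fa_surj u uA; have [|j jv] := fb_surj v; first by rewrite inE.
  exists (exist _ (i, j) isT : edge K33).
  apply: (card_le1_eqP (card_parallel_edges (neq_sides (faA i) (fbA j)))); rewrite inE ?gP //.
  by rewrite ee iu jv.
by move=> p; rewrite gP /= /incidence_ends imsetU1 imset_set1.
Qed.

End Simple.

Hypothesis irreducible : forall K, #|cut K| = 3 -> #|K| <= 1 \/ #|~: K| <= 1.

Lemma irreducible_c4ec : cyclically_edge_connected G 4.
Proof.
move=> X [_ [K1 [K2 [/existsP[u1 /eqP K1E] /existsP[u2 /eqP K2E] ne]]]].
have csym := sym_connect_sym (@adj_sym G (~: X)).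
have dis : K2 \subset ~: K1.
  apply/subsetP => w wK2; rewrite inE; apply: contra ne => wK1; apply/eqP/setP => z.
  move: wK1 wK2; rewrite K1E K2E !inE => h1 h2.
  by rewrite (same_connect csym h1) -(same_connect csym h2).
have cycle2 K : contains_cycle X K -> 2 <= #|K|.
  case/existsP => C /and3P[/and3P[/set0Pn[e eC] _ _] _ /forallP/(_ e)].
  by rewrite eC => /subset_leq_card; rewrite card_ends.
move=> /cycle2 c1 /cycle2 c2; have c2' := leq_trans c2 (subset_leq_card dis).
have cutX : cut K1 \subset X.
  apply/subsetP => e /cutP[x [y [xe ye]]]; rewrite K1E !inE => ux; apply: contraNT => eX.
  by apply: connect_trans ux (connect_ends (e := e) _ xe ye); rewrite inE.
rewrite leqNgt; apply/negP => X4.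
have : 3 <= #|cut K1|.
  apply: (cut_ge3 bA) => //; first by rewrite -card_gt0; lia.
  by apply: neq_setT; have := cardsC K1; lia.
have := subset_leq_card cutX => h1 h2.
by case: (@irreducible K1); lia.
Qed.

(* If Hall's condition holds outside a 4-cycle C, then C is a component of a
   2-factor; otherwise a violating set yields a nontrivial 3-edge-cut. *)
Lemma four_cycle_card6 C : 2 < #|vertex G| -> cycle_set C -> #|C| = 4 ->
  #|vertex G| = 6.
Proof.
move=> V2 cC C4; have A3 := card_side_ge3 V2.
have bB := bipartitionC bA.
set W := cov C; pose B := ~: A.
have WA : #|W :&: A| = 2 by have := cycle_side_card bA cC; rewrite C4 -/W; lia.
have WB : #|W :&: B| = 2 by have := cycle_side_card bB cC; rewrite C4 -/W -/B; lia.
have W4 : #|W| = 4 by rewrite -(cardsID A W) setDE WA -/B WB.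
have degF v : deg (~: C) v + 2 * (v \in W) = 3.
  have /regularP/(_ v) := cG; rewrite -(deg_setID setT C v) setTI setTD => <-.
  rewrite addnC; congr (_ + _); case: (boolP (v \in W)) => [/(cycle_deg cC) -> //|].
  by rewrite inE; case: posnP.
have sumF T : \sum_(v in T) deg (~: C) v + 2 * #|W :&: T| = 3 * #|T|.
  rewrite setIC card_setI_sum big_distrr -big_split /=; under eq_bigr do rewrite degF.
  by rewrite sum_nat_const mulnC.
case: (boolP (hall_condition A (~: C))) => [hall|].
  have [M pM MC] := hall_perfect_matching bA card_side hall.
  have tM := two_factorC cG pM.
  have CM : C \subset ~: M by rewrite subsetC.
  have [u uW] : exists u, u \in W by apply/card_gt0P; rewrite W4.
  have WT : W != setT by apply: neq_setT; rewrite W4 card_vertices; lia.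
  have /subsetPn[v _ vW] : ~~ (setT \subset W) by rewrite subTset.
  have [e eM /cutP[x [y [xe ye xW yW]]]] := spanning_connectedP _ (hamG tM) W u v uW vW.
  have E : [set f in C | x \in ends f] = [set f in ~: M | x \in ends f].
    apply/eqP; rewrite eqEcard; apply/andP; split.
      apply/subsetP => f; rewrite !inE => /andP[fC ->]; rewrite andbT.
      by have := subsetP CM f fC; rewrite inE.
    have /regularP/(_ x) := tM; rewrite /deg => ->.
    by rewrite -[X in _ <= X]/(deg C x) (cycle_deg cC).
  have : e \in [set f in C | x \in ends f] by rewrite E inE eM.
  by rewrite inE => /andP[eC _]; rewrite (mem_cov eC ye) in yW.
rewrite negb_forall => /existsP[S]; rewrite negb_imply -ltnNge => /andP[SA].
set N := nbr A (~: C) S => ltN.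
have NB : N \subset B by apply/subsetP => v; rewrite inE => /andP[].
have le : \sum_(v in S) deg (~: C) v <= \sum_(v in N) deg (~: C) v.
  by rewrite !handshake; apply: leq_sum => e; exact: card_ends_nbr.
have WS : #|W :&: S| <= 2 by rewrite -WA subset_leq_card // setIS.
have sS := sumF S; have sN := sumF N.
have [WS2 WN0 cN] : [/\ #|W :&: S| = 2, #|W :&: N| = 0 & #|S| = #|N|.+1].
  by split; lia.
have WAS : W :&: A \subset S.
  have /eqP <- : W :&: S == W :&: A by rewrite eqEcard setIS // WA WS2.
  exact: subsetIr.
pose K := S :|: (N :|: (W :&: B)).
have cNW : #|N :|: (W :&: B)| = #|N| + 2.
  have := cardsUI N (W :&: B); rewrite WB.
  have -> : N :&: (W :&: B) = set0.
    apply/eqP; rewrite -cards_eq0 -leqn0 -WN0; apply/subset_leq_card/subsetP => v.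
    by rewrite !in_setI => /and3P[-> ->].
  by rewrite cards0 addn0.
have NWB : N :|: (W :&: B) \subset B by rewrite subUset NB subsetIr.
have cK : #|K| = 2 * #|S| + 1.
  have := cardsUI S (N :|: (W :&: B)); rewrite -/K cNW.
  have -> : S :&: (N :|: (W :&: B)) = set0.
    apply/eqP; rewrite setI_eq0; apply/pred0P => v /=; apply/negP => /andP[vS].
    by move/(subsetP NWB); rewrite inE (subsetP SA).
  by rewrite cards0; lia.
have insideK : inside K = [set e | touches S e].
  apply/setP => e; rewrite !inE; have [x [y [ee xA yA]]] := bip_ends bA e.
  apply/subsetP/touchesP => [sub|[v ve vS]].
    have xe : x \in ends e by rewrite ee !inE eqxx.
    exists x => //; have := sub x xe; rewrite in_setU => /orP[//|/(subsetP NWB)].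
    by rewrite inE xA.
  have vx : v = x.
    move: ve; rewrite ee !inE => /orP[/eqP //|/eqP vy].
    by rewrite -vy (subsetP SA) in yA.
  move=> w; rewrite ee in_set2 /K !in_setU => /orP[/eqP ->|/eqP ->].
    by rewrite -vx vS.
  have ye : y \in ends e by rewrite ee !inE eqxx orbT.
  have [eC|eC] := boolP (e \in C).
    have yW : y \in W by exact: mem_cov eC ye.
    by rewrite in_setI yW in_setC yA !orbT.
  suff -> : y \in N by rewrite orbT.
  by apply/nbrP; split=> //; exists e, v; rewrite inE eC.
have iK : #|inside K| = 3 * #|S|.
  by rewrite insideK -(regular_sum S cG) (sum_deg_touches _ bA SA) setTI.
have cutK : #|cut K| = 3 by have := cut_inside K; rewrite iK cK; lia.
have S2 : 2 <= #|S| by rewrite -WA subset_leq_card.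
have AS : #|A| = #|S|.+1.
  have := cardsC K; rewrite card_vertices cK.
  by case: (irreducible cutK); rewrite ?cK; lia.
have /cards1P[w wE] : #|A :\: S| == 1.
  by have := cardsID S A; rewrite (setIidPr SA); lia.
have [wA wS] : w \in A /\ w \notin S.
  by have /setP/(_ w) := wE; rewrite !inE eqxx => /andP[].
pose J := w |: W.
have wW : w \notin W by apply: contra wS => wW; apply: (subsetP WAS); rewrite inE wW.
have cJ : #|J| = 5 by rewrite cardsU1 wW W4.
pose D := ~: C :&: [set e | touches (W :&: B) e].
have cD : #|D| = 2.
  have := sumF (W :&: B); rewrite (sum_deg_touches _ bB (subsetIr _ _)).
  by rewrite setIA setIid WB -/D; lia.
have iJ : 6 <= #|inside J|.
  have -> : 6 = #|C :|: D|.
    have := cardsUI C D; rewrite C4 cD (_ : C :&: D = set0) ?cards0 ?addn0 //.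
    by rewrite /D setIA setICr set0I.
  apply/subset_leq_card; rewrite subUset; apply/andP; split; apply/subsetP => e.
    move=> eC; rewrite inE; apply/subsetP => v ve; rewrite in_setU1.
    by rewrite (mem_cov eC ve) orbT.
  rewrite in_setI in_setC inE => /andP[eC /touchesP[b be]]; rewrite in_setI => /andP[bW bB'].
  have [x [y [ee xA yA]]] := bip_ends bA e.
  have bA' : b \notin A by move: bB'; rewrite inE.
  have by_ : b = y.
    by move: be; rewrite ee !inE => /orP[/eqP bx|/eqP //]; rewrite bx xA in bA'.
  have xw : x = w.
    apply/set1P; rewrite -wE inE xA andbT; apply/negP => xS.
    suff bN : b \in N by have := WN0; rewrite (cardD1 b) inE bW bN.
    by apply/nbrP; split=> //; exists e, x; rewrite inE eC ee !inE eqxx by_ eqxx orbT.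
  rewrite inE ee; apply/subsetP => z; rewrite in_set2 in_setU1 => /orP[/eqP ->|/eqP ->].
    by rewrite xw eqxx.
  by rewrite -by_ bW orbT.
have V6 : 6 <= #|vertex G| by rewrite card_vertices; lia.
have : 3 <= #|cut J|.
  apply: (cut_ge3 bA) => //; first by rewrite -card_gt0 cJ.
  by apply: neq_setT; rewrite cJ.
have := cut_inside J; rewrite cJ => h1 h2.
have := cardsC J; rewrite card_vertices cJ.
by case: (@irreducible J); [lia | rewrite cJ | lia].
Qed.

Lemma irreducible_girth : 2 < #|vertex G| -> #|vertex G| != 6 -> girth_geq G 6.
Proof.
move=> V2 V6 C cC; rewrite leqNgt; apply/negP => C6.
have hA := cycle_side_card bA cC; have hB := cycle_side_card (bipartitionC bA) cC.
have [C2|C4] : #|C| = 2 \/ #|C| = 4.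
  have : 0 < #|C| by rewrite card_gt0; case/and3P: cC.
  lia.
  have W2 : #|cov C| = 2 by have := cardsID A (cov C); rewrite setDE; lia.
  have := cut_inside (cov C); rewrite W2.
  have : 3 <= #|cut (cov C)|.
    apply: (cut_ge3 bA) => //; first by rewrite -card_gt0 W2.
    by apply: neq_setT; rewrite W2.
  have : #|C| <= #|inside (cov C)|.
    apply/subset_leq_card/subsetP => e eC; rewrite inE; apply/subsetP => v.
    exact: mem_cov.
  lia.
by move/eqP: V6; apply; exact: four_cycle_card6 cC C4.
Qed.

End Irreducible.

Lemma isomorphic_sym G H : isomorphic G H -> isomorphic H G.
Proof.
case=> f [g [[f' fK f'K] [g' gK g'K] fg]]; exists f', g'; split.
- by exists f.
- by exists g.
move=> e; rewrite -{2}(g'K e) fg -imset_comp -[LHS]imset_id.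
by apply: eq_imset => x /=; rewrite fK.
Qed.

Lemma isomorphic_card G H : isomorphic G H ->
  #|vertex G| = #|vertex H| /\ #|edge G| = #|edge H|.
Proof. by case=> f [g [/bij_eq_card ? /bij_eq_card ? _]]. Qed.

Lemma isomorphic_theta (G : mgraph) : cubic G -> #|vertex G| = 2 -> isomorphic G theta.
Proof.
move=> cG V2; have E3 : #|edge G| = 3.
  have := handshakeT [set: edge G]; rewrite cardsT.
  have := regular_sum setT cG; rewrite cardsT V2 big_mkcond /=.
  by under eq_bigr do rewrite inE; lia.
exists (fun v => cast_ord V2 (enum_rank v) : vertex theta).
exists (fun e => cast_ord E3 (enum_rank e) : edge theta).
have bij (T : finType) n (h : #|T| = n) : bijective (fun x : T => cast_ord h (enum_rank x)).
  exists (fun i => enum_val (cast_ord (esym h) i)) => x.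
    by rewrite cast_ordK enum_rankK.
  by rewrite enum_valK cast_ordKV.
split; [exact: bij | exact: bij | move=> e].
apply/eqP; rewrite eq_sym eqEcard subsetT /= cardsT card_ord.
by rewrite card_imset ?card_ends //; apply: bij_inj (bij _ _ V2).
Qed.

Lemma card_star_graph (G1 G2 H : mgraph) : star_product G1 G2 H ->
  #|vertex H| = #|vertex G1|.-1 + #|vertex G2|.-1.
Proof.
case=> v1 [v2 [a [b [av [bv [_ _ _ _ /isomorphic_card[<- _]]]]]]].
rewrite card_sum !card_sig -!(cardC1 v1) -!(cardC1 v2).
by congr (_ + _); apply: eq_card.
Qed.

Lemma star_generated_card G : star_generated G -> 4 <= #|vertex G|.
Proof.
elim=> {G} [G /isomorphic_card[<- _]|G /isomorphic_card[<- _]|G1 G2 H _ h1 _ h2 /card_star_graph ->].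
- by rewrite card_sum !card_ord.
- by rewrite card_sum !card_ord.
lia.
Qed.

Lemma girth_dense (G : mgraph) k (F : {set edge G}) : girth_geq G k -> F != set0 ->
  #|cov F| <= #|F| -> k <= #|F|.
Proof.
move=> gG F0 cF; have [C cC CF] := cycle_in F0 cF.
exact: leq_trans (gG C cC) (subset_leq_card CF).
Qed.

Lemma girth_not_theta G : girth_geq G 6 -> ~ isomorphic G theta.
Proof.
move=> gG /isomorphic_card[]; rewrite !card_ord => V2 E3.
have := @girth_dense _ _ setT gG; rewrite -card_gt0 cardsT E3 => /(_ isT).
by have := max_card (cov [set: edge G]); rewrite V2; lia.
Qed.

Lemma girth_not_K33 G : girth_geq G 6 -> ~ isomorphic K33 G.
Proof.
move=> gG [f [g [bf bg fg]]].
pose q (p : 'I_2 * 'I_2) : edge K33 := exist _ (lift ord0 p.1, lift ord0 p.2) isT.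
have q_inj : injective q.
  move=> [i j] [i' j'] E; have /lift_inj /= -> := congr1 (fun e => (val e).1) E.
  by have /lift_inj /= -> := congr1 (fun e => (val e).2) E.
pose F := (g \o q) @: setT.
have F4 : #|F| = 4.
  rewrite card_imset ?cardsT ?card_prod ?card_ord //.
  exact: inj_comp (bij_inj bg) q_inj.
suff : #|cov F| <= 4.
  by have := @girth_dense _ _ F gG; rewrite -card_gt0 F4 => /(_ isT) h /h.
pose WL := [set f (inl (lift ord0 i)) | i : 'I_2].
pose WR := [set f (inr (lift ord0 i)) | i : 'I_2].
have sub : cov F \subset WL :|: WR.
  apply/subsetP => v; rewrite inE => /deg_gt0P[_ /imsetP[[i j] _ ->]].
  rewrite fg => /imsetP[w]; rewrite /= !inE => /orP[]/eqP -> ->.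
    by rewrite imset_f.
  by rewrite imset_f ?orbT.
apply: leq_trans (subset_leq_card sub) _; apply: leq_trans (leq_card_setU _ _) _.
by apply: (@leq_add _ _ 2 2); apply: leq_trans (leq_imset_card _ _) _; rewrite card_ord.
Qed.

Section CycleSeparating.

Variable G : mgraph.
Hypothesis cG : cubic G.
Implicit Types (K : {set vertex G}).

Lemma cyclic_component K : #|cut K| <= 3 -> 3 <= #|K| ->
  exists K1, [/\ component (cut K) K1, K1 != set0, K1 \subset K & contains_cycle (cut K) K1].
Proof.
move=> cutK K3; have := regular_cut_inside K cG; rewrite !setTI => h.
have covK : cov (inside K) \subset K.
  apply/subsetP => v; rewrite inE => /deg_gt0P[e]; rewrite inE => /subsetP; exact.
have [||C cC CK] := @cycle_in G (inside K).
- by rewrite -card_gt0; lia.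
- by have := subset_leq_card covK; lia.
have [/set0Pn[e eC] _ _] := and3P cC.
have [u ue] := ends_nonempty e; have uC := mem_cov eC ue.
have uK : u \in K by apply: (subsetP covK); apply: (subsetP (sub_cov CK)).
have CX : C \subset ~: cut K.
  apply/subsetP => f /(subsetP CK); rewrite in_setC => fK.
  apply/negP => /cutP[x [y [_ ye _]]]; move: fK; rewrite inE => /subsetP/(_ y ye) ->.
  by [].
exists [set v | connect (adj (~: cut K)) u v]; split.
- by apply/existsP; exists u.
- by apply/set0Pn; exists u; rewrite inE connect0.
- apply/subsetP => v; rewrite inE => uv; apply: connect_cut uv uK.
  by rewrite setIC setICr.
apply/existsP; exists C; rewrite cC CX /=; apply/forallP => f; apply/implyP => fC.
apply/subsetP => v vf; rewrite inE.
have := cycle_connected cC uC (mem_cov fC vf); apply: connect_sub => x y.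
case/existsP => f' /andP[f'C ff']; apply: connect1; apply/existsP; exists f'.
by rewrite (subsetP CX).
Qed.

Lemma cycle_separating_cut K : #|cut K| <= 3 -> 3 <= #|K| -> 3 <= #|~: K| ->
  cycle_separating (cut K).
Proof.
move=> cutK K3 KC3; have [K1 [c1 n1 s1 o1]] := cyclic_component cutK K3.
have := @cyclic_component (~: K); rewrite cutC => /(_ cutK KC3)[K2 [c2 n2 s2 o2]].
have [x x1] := set0Pn _ n1; have [y y2] := set0Pn _ n2.
have xK := subsetP s1 x x1; have yK : y \notin K by have := subsetP s2 y y2; rewrite inE.
split.
  apply/negP => /forallP/(_ x)/forallP/(_ y) xy; move/negP: yK; apply.
  by apply: connect_cut xy xK; rewrite setIC setICr.
exists K1, K2; split=> //; apply: contraNneq yK => E.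
by apply: (subsetP s1); rewrite E.
Qed.

End CycleSeparating.

Lemma star_product_not_c4ec (G1 G2 G : mgraph) : cubic G -> 4 <= #|vertex G1| ->
  4 <= #|vertex G2| -> star_product G1 G2 G -> ~ cyclically_edge_connected G 4.
Proof.
move=> cG V1 V2 sp cec; have cV := card_star_graph sp.
case: sp => v1 [v2 [a [b [av [bv [_ _ _ _ [f [g [bf bg fg]]]]]]]]].
pose L := [set w : vertex (star_graph av bv) | if w is inl _ then true else false].
have f_inj := bij_inj bf.
have cL : #|L| = #|vertex G1|.-1.
  rewrite card_star_vertex (_ : [set y | inr y \in L] = set0); last first.
    by apply/setP => y; rewrite !inE.
  rewrite (_ : [set x | inl x \in L] = setT); last by apply/setP => y; rewrite !inE.
  by rewrite cards0 addn0 cardsT card_sig -(cardC1 v1); apply: eq_card.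
have cK : #|f @: L| = #|vertex G1|.-1 by rewrite card_imset.
have cutK : cut (f @: L) \subset (g \o inr) @: [set: 'I_3].
  apply/subsetP => e; have [g' gK g'K] := bg; rewrite -(g'K e).
  case: (g' e) => [[e1|e2]|i] /cutP[x [y []]].
  - rewrite fg => _ /imsetP[[w|w] we ->] _; last by rewrite inE in we.
    by rewrite mem_imset // inE.
  - rewrite fg => /imsetP[[w|w] we ->] _; first by rewrite inE in we.
    by rewrite mem_imset // inE.
  by move=> _ _ _ _; apply/imsetP; exists i.
have cut3 : #|cut (f @: L)| <= 3.
  apply: leq_trans (subset_leq_card cutK) _.
  by apply: leq_trans (leq_imset_card _ _) _; rewrite cardsT card_ord.
have := cardsC (f @: L); rewrite cK cV => h.
have := cec _ (cycle_separating_cut cG cut3 _ _); rewrite cK; lia.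
Qed.

Lemma contract_not_theta (G : mgraph) (K : {set vertex G}) : 2 <= #|K| ->
  ~ isomorphic (contract K) theta.
Proof. by move=> K2 /isomorphic_card[]; rewrite card_contract card_ord; lia. Qed.

Theorem mainTheorem3 :
  (forall G : mgraph,
     connected G -> bipartite G -> cubic G -> two_factor_hamiltonian G ->
     ~ isomorphic G theta ->
     star_generated G)
  <->
  (forall G : mgraph,
     connected G -> bipartite G -> cyclically_edge_connected G 4 -> cubic G ->
     PMH G -> girth_geq G 6 -> ~ isomorphic G heawood ->
     exists M : {set edge G},
       perfect_matching M /\ exists! N : {set edge G}, extends_to_ham M N).
Proof.
split=> [hA G cG bG cec c3 pG gG nH|hB].
  have [/existsP[M /andP[pM /eqP ext1]]|none] := boolP [exists M : {set edge G},
      perfect_matching M && (#|[set N | extends_to_ham M N]| == 1)].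
    exists M; split=> //; have /eqP/cards1P[N hN] := ext1.
    have inN N' : extends_to_ham M N' = (N' == N).
      by have /setP/(_ N') := hN; rewrite !inE.
    by exists N; split=> [|N']; rewrite inN // => /eqP.
  have tG : two_factor_hamiltonian G.
    apply: two_extensions_2FH => // M pM [N [eN uN]].
    move/negP: none; apply; apply/existsP; exists M; rewrite pM /=.
    apply/cards1P; exists N; apply/setP => N'; rewrite !inE.
    by apply/idP/eqP => [/uN ->|->].
  have sG := hA G cG bG c3 tG (girth_not_theta gG).
  case: sG cec c3 gG nH {cG bG pG none tG}.
  - by move=> H iH _ _ gH; case: (girth_not_K33 gH iH).
  - by move=> H iH _ _ _ []; exact: isomorphic_sym.
  move=> G1 G2 H g1 g2 sp cec c3.
  by case: (star_product_not_c4ec c3 (star_generated_card g1) (star_generated_card g2) sp cec).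
move=> G; have [n] := ubnP #|vertex G|; elim: n G => // n IH G ltn conG [A bA] cG [_ tG] nT.
have hamG (F : {set edge G}) : two_factor F -> spanning_connected F by move=> tF; have /andP[] := tG F tF.
have V2 : 2 < #|vertex G|.
  have := card_vertices bA cG; have /andP[V0 _] := conG => VA.
  by have [/(isomorphic_theta cG)|] := eqVneq #|vertex G| 2; [|lia].
have [/existsP[K /and3P[/eqP K3 K2 KC2]]|irr] :=
    boolP [exists K : {set vertex G}, [&& #|cut K| == 3, 1 < #|K| & 1 < #|~: K|]].
  have side (B L : {set vertex G}) : bipartition B -> side_cut (~: B) L = set0 ->
      #|cut L| = 3 -> 1 < #|L| -> 1 < #|~: L| -> star_generated (contract L).
    move=> bB sL L3 L2 LC2; have cL := cardsC L.
    have [|c1 c2 c3] := @contract_2FH G L B bB cG hamG L3.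
      by apply: neq_setT; lia.
    apply: IH => //; [by rewrite card_contract; lia | exact: contract_bipartite bB sL |].
    exact: contract_not_theta.
  have KC3 : #|cut (~: K)| = 3 by rewrite cutC.
  have KC : 1 < #|~: ~: K| by rewrite setCK.
  have [B bB [s1 s2]] : exists2 B : {set vertex G}, bipartition B &
      side_cut (~: B) K = set0 /\ side_cut B (~: K) = set0.
    have bC := bipartitionC bA.
    have h B : bipartition B -> side_cut (~: B) K = set0 -> side_cut B (~: K) = set0.
      move=> bB s0; case: (cut_one_side bB cG KC3) => // s1.
      apply/setP => e; rewrite [RHS]inE; apply/negP => eB.
      have : e \in cut K by rewrite -cutC (cut_sides bB) in_setU eB.
      rewrite (cut_sides bB) s0 setU0 in_set => /andP[/eqP h1 _].
      move: eB; rewrite inE => /andP[/eqP h2 _].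
      have := cardsUI (ends e :&: (K :&: B)) (ends e :&: (~: K :&: B)).
      have -> : ends e :&: (K :&: B) :|: ends e :&: (~: K :&: B) = ends e :&: B.
        by rewrite -setIUr -setIUl setUCr setTI.
      by rewrite h1 h2 bB (_ : _ :&: _ = set0) ?cards0 //; apply/setP => x; rewrite !inE; do 3 case: (_ \in _).
    have [sA|sA] := cut_one_side bA cG K3; last by exists A => //; split=> //; exact: h.
    by exists (~: A) => //; split; [rewrite setCK | apply: h; rewrite ?setCK].
  apply: star_generated_star (side B K _ _ _ _ _) (side (~: B) (~: K) _ _ _ _ _) _ => //.
  - exact: bipartitionC.
  - by rewrite setCK.
  exact: star_decomposition.
have irred (K : {set vertex G}) : #|cut K| = 3 -> #|K| <= 1 \/ #|~: K| <= 1.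
  move=> K3; move/negP: irr => irr.
  have [|K2] := leqP #|K| 1; first by left.
  have [|KC2] := leqP #|~: K| 1; first by right.
  by case: irr; apply/existsP; exists K; rewrite K3 K2 KC2.
have [V6|V6] := eqVneq #|vertex G| 6.
  exact/star_generated_K33/(K33_of_card6 bA cG hamG V2 V6).
have [/star_generated_heawood //|nH] := classic (isomorphic heawood G).
have [M [pM uM]] := hB G conG (ex_intro _ A bA) (irreducible_c4ec bA cG hamG irred) cG
  (hamiltonian_PMH cG bA hamG) (irreducible_girth bA cG hamG irred V2 V6) (fun h => nH (isomorphic_sym h)).
have [v _] := A_nonempty bA cG V2.
by case: (hamiltonian_extension_not_unique cG hamG v pM uM).
Qed.
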